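(* Let $\mathcal{H}$ be a set of two connected graphs, each of order at least $3$. If there exists a positive integer $n_0=n_0(\mathcal{H})$ such that every $2$-connected $\mathcal{H}$-free graph of order at least $n_0$ has a dominating cycle, then $\mathcal{H}\le \mathcal{H}_i$ for some $i$ with $1\le i\le 7$, where $\mathcal{H}_1=\{K_{1,3},Z_4\}$, $\mathcal{H}_2=\{K_{1,3},B_{1,2}\}$, $\mathcal{H}_3=\{K_{1,3},N_{1,1,1}\}$, $\mathcal{H}_4=\{P_4,W\}$, $\mathcal{H}_5=\{K_{1,3}^{*},Z_1\}$, $\mathcal{H}_6=\{P_5,W^{*}\}$, $\mathcal{H}_7=\{P_5,K_4^{-}\}$.
   Context: All graphs are finite and simple. A cycle $C$ in a graph $G$ is dominating if every edge of $G$ has at least one end vertex on $C$. For a set $\mathcal{H}$ of connected graphs, $G$ is $\mathcal{H}$-free if $G$ contains no member of $\mathcal{H}$ as an induced subgraph. For graphs $H_1,H_2$, write $H_1\prec H_2$ if $H_1$ is an induced subgraph of $H_2$; for sets $\mathcal{H}_1,\mathcal{H}_2$ of connected graphs, $\mathcal{H}_1\le\mathcal{H}_2$ means that for every $H_2\in\mathcal{H}_2$ there is $H_1\in\mathcal{H}_1$ with $H_1\prec H_2$. $P_n$ is the path of order $n$, $K_n$ the complete graph, $K_{1,3}$ the claw. $Z_n$ is obtained from a triangle by attaching a path with $n$ new vertices at one triangle vertex (i.e. identifying an end of $P_{n+1}$ with a triangle vertex). $B_{m,n}$ is obtained from a triangle $abc$ by attaching a path of $m$ new vertices at $a$ and a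 path of $n$ new vertices at $b$. $N_{l,m,n}$ is obtained from a triangle $abc$ by attaching paths of $l$, $m$, $n$ new vertices at $a$, $b$, $c$ respectively. $K_{1,3}^{*}$ is the graph obtained from $K_{1,3}$ by subdividing each edge once. $W=K_1+3K_2$ (one vertex joined to all vertices of three disjoint edges), $W^{*}=K_1+(K_1\cup 2K_2)$, and $K_4^{-}$ is $K_4$ minus one edge. Here $+$ denotes join and $\cup$ disjoint union. *)

(* Defs.v *)
From HB Require Import structures.
From mathcomp Require Import all_boot.

Set Implicit Arguments.
Unset Strict Implicit.
Unset Printing Implicit Defensive.

Record sgraph := SGraph {
  vertex :> finType;
  adj : rel vertex;
  adj_sym : symmetric adj;
  adj_irrefl : irreflexive adj
}.

Definition isomorphic (G H : sgraph) : Prop :=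
  exists2 f : G -> H, bijective f & forall x y, adj (f x) (f y) = adj x y.

Section Induced.
Variables (G : sgraph) (S : {set G}).

Definition induced_adj : rel {x : G | x \in S} :=
  [rel x y | adj (val x) (val y)].

Fact induced_sym : symmetric induced_adj.
Proof. by move=> x y; apply: adj_sym. Qed.

Fact induced_irrefl : irreflexive induced_adj.
Proof. by move=> x; apply: adj_irrefl. Qed.

Definition induced : sgraph := SGraph induced_sym induced_irrefl.
End Induced.

Definition induced_subgraph (H G : sgraph) : Prop :=
  exists S : {set G}, isomorphic H (induced S).

(* A set of graphs; every notion below depends only on its members up to
   isomorphism. *)
Definition graph_set : Type := sgraph -> Prop.

Definition graph_pair (A B : sgraph) : graph_set := fun G => G = A \/ G = B.

Definition graph_free (HH : graph_set) (G : sgraph) : Prop :=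
  forall H, HH H -> ~ induced_subgraph H G.

Definition graph_set_le (HH1 HH2 : graph_set) : Prop :=
  forall H2, HH2 H2 -> exists2 H1, HH1 H1 & induced_subgraph H1 H2.

Definition connected (G : sgraph) : Prop :=
  0 < #|G| /\ forall x y : G, connect (@adj G) x y.

Definition k_connected (k : nat) (G : sgraph) : Prop :=
  k < #|G| /\ forall X : {set G}, #|X| < k -> connected (induced (~: X)).

(* The sequence lists each vertex of the cycle once, in cyclic order; the size
   condition excludes the degenerate closed walks that [ucycle] accepts. *)
Definition is_cycle (G : sgraph) (c : seq G) : Prop :=
  3 <= size c /\ ucycle (@adj G) c.

Definition dominating (G : sgraph) (c : seq G) : Prop :=
  forall x y : G, adj x y -> (x \in c) || (y \in c).

Definition has_dominating_cycle (G : sgraph) : Prop :=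
  exists2 c : seq G, is_cycle c & dominating c.

Section Complete.
Variable n : nat.

Definition complete_adj : rel 'I_n := [rel i j | i != j].

Fact complete_sym : symmetric complete_adj.
Proof. by move=> i j; rewrite /complete_adj /= eq_sym. Qed.

Fact complete_irrefl : irreflexive complete_adj.
Proof. by move=> i; rewrite /complete_adj /= eqxx. Qed.

Definition complete : sgraph := SGraph complete_sym complete_irrefl.
End Complete.

Section PathGraph.
Variable n : nat.

Definition path_adj : rel 'I_n :=
  [rel i j : 'I_n | (i.+1 == j :> nat) || (j.+1 == i :> nat)].

Fact path_adj_sym : symmetric path_adj.
Proof. by move=> i j; rewrite /path_adj /= orbC. Qed.

Fact path_adj_irrefl : irreflexive path_adj.
Proof. by move=> i; rewrite /path_adj /= orbb gtn_eqF. Qed.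

(* The path of order [n], with vertices in their natural order. *)
Definition path_graph : sgraph := SGraph path_adj_sym path_adj_irrefl.
End PathGraph.

Section SumGraph.
Variables (G H : sgraph) (e : G -> H -> bool).

(* Disjoint copies of [G] and [H] with the cross edges given by [e]. *)
Definition sum_adj : rel (G + H)%type := fun u v =>
  match u, v with
  | inl x, inl y => adj x y
  | inr x, inr y => adj x y
  | inl x, inr y => e x y
  | inr y, inl x => e x y
  end.

Fact sum_adj_sym : symmetric sum_adj.
Proof. by case=> x [] y //=; apply: adj_sym. Qed.

Fact sum_adj_irrefl : irreflexive sum_adj.
Proof. by case=> x /=; apply: adj_irrefl. Qed.

Definition sum_graph : sgraph := SGraph sum_adj_sym sum_adj_irrefl.
End SumGraph.

Definition disjoint_union (G H : sgraph) : sgraph :=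
  @sum_graph G H (fun _ _ => false).

Definition join (G H : sgraph) : sgraph := @sum_graph G H (fun _ _ => true).

(* Attach a path with [n] new vertices at [x]: [x] becomes adjacent to the
   first vertex of a new path of order [n] (nothing changes when [n = 0]). *)
Definition attach_path (G : sgraph) (x : G) (n : nat) : sgraph :=
  @sum_graph G (path_graph n) (fun y i => (y == x) && (i == 0 :> nat)).

Section DeleteEdge.
Variables (G : sgraph) (x y : G).

Definition delete_edge_adj : rel G :=
  [rel u v | adj u v && ([set u; v] != [set x; y])].

Fact delete_edge_sym : symmetric delete_edge_adj.
Proof. by move=> u v; rewrite /delete_edge_adj /= adj_sym setUC. Qed.

Fact delete_edge_irrefl : irreflexive delete_edge_adj.
Proof. by move=> u; rewrite /delete_edge_adj /= adj_irrefl. Qed.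

Definition delete_edge : sgraph := SGraph delete_edge_sym delete_edge_irrefl.
End DeleteEdge.

Section Subdivision.
Variable G : sgraph.

Definition is_edge (s : {set G}) : bool :=
  [exists x, exists y, adj x y && (s == [set x; y])].

(* An original vertex is adjacent exactly to the (subdivision vertices of the)
   edges containing it. *)
Definition subdivision_adj : rel (G + {s : {set G} | is_edge s})%type :=
  fun u v => match u, v with
  | inl x, inr s => x \in val s
  | inr s, inl x => x \in val s
  | _, _ => false
  end.

Fact subdivision_sym : symmetric subdivision_adj.
Proof. by case=> x [] y. Qed.

Fact subdivision_irrefl : irreflexive subdivision_adj.
Proof. by case. Qed.

Definition subdivision : sgraph := SGraph subdivision_sym subdivision_irrefl.
End Subdivision.

Definition claw : sgraph :=
  join (complete 1)
    (disjoint_union (complete 1) (disjoint_union (complete 1) (complete 1))).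

Definition claw_star : sgraph := subdivision claw.

Definition tri_a : complete 3 := inord 0.
Definition tri_b : complete 3 := inord 1.
Definition tri_c : complete 3 := inord 2.

Definition Zgraph (n : nat) : sgraph := attach_path tri_a n.

(* The vertices of the triangle survive each attachment through [inl]. *)
Definition Bgraph (m n : nat) : sgraph :=
  @attach_path (attach_path tri_a m) (inl tri_b) n.

Definition Ngraph (l m n : nat) : sgraph :=
  @attach_path (@attach_path (attach_path tri_a l) (inl tri_b) m)
    (inl (inl tri_c)) n.

Definition Wgraph : sgraph :=
  join (complete 1)
    (disjoint_union (complete 2) (disjoint_union (complete 2) (complete 2))).

Definition Wstar : sgraph :=
  join (complete 1)
    (disjoint_union (complete 1) (disjoint_union (complete 2) (complete 2))).

Definition K4minus : sgraph := @delete_edge (complete 4) (inord 0) (inord 1).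

(* Only the indices 1, ..., 7 are meaningful. *)
Definition forbidden_family (i : nat) : graph_set :=
  match i with
  | 1 => graph_pair claw (Zgraph 4)
  | 2 => graph_pair claw (Bgraph 1 2)
  | 3 => graph_pair claw (Ngraph 1 1 1)
  | 4 => graph_pair (path_graph 4) Wgraph
  | 5 => graph_pair claw_star (Zgraph 1)
  | 6 => graph_pair (path_graph 5) Wstar
  | 7 => graph_pair (path_graph 5) K4minus
  | _ => fun _ => False
  end.

(* Main.v *)
Require Import Defs.
From HB Require Import structures.
From mathcomp Require Import all_boot.
From mathcomp Require Import zify.
From Stdlib Require Import Classical.

Set Implicit Arguments.
Unset Strict Implicit.
Unset Printing Implicit Defensive.

(* Every 2-connected graph without a dominating cycle contains A or B once it is
   large enough, so each family of such graphs restricts the pair.  Long theta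
   graphs force one of the two, say A, to be an induced subgraph of a spider with
   three legs.

   If A contains a claw, B lies in every claw-free family: long prisms make B a
   net with three legs, and short prisms whose paths are replaced by cliques
   bound its legs, so that B is below Z_4, B_{1,2} or N_{1,1,1}.  If moreover A is
   not a claw, A contains P_4, and so B does not, since K_2 + 3K_m is P_4-free;
   this leaves Z_1 for B, and a triangle-free family bounds A by the subdivided
   claw.

   If A is a path P_k with k >= 4, three P_4-free families of large graphs with a
   2-cut put B below W or K_4^-; then a P_5-free family excludes W for k >= 5, and
   a triangle-free, P_6-free one leaves only the claw for k >= 6, where k <= 6
   because of a claw-free family of independence number 3. *)

(** * Embeddings *)

(** Spiders and nets arise because a connected graph with fewer vertices than each path of a theta
    graph or prism misses a vertex of every path, and so lies around one end. The remaining families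
    have a fixed number of twin classes, so 2-connectedness and the absence of a pattern are finite
    computations valid for all sizes. Two short prisms are needed since B_{2,2} has independence
    number 3: it still occurs in [clique_prism], on a triangle through both gates of a row, and
    [diamond_prism] has no such triangle. For a path A, the class found for B is recorded twice:
    once against K_4^-, W^* and W, for short paths, and once against the triangle, P_3 and the claw,
    for paths of order at least 6. *)

Definition embeds (H G : sgraph) : Prop :=
  exists2 f : H -> G, injective f & forall x y, adj (f x) (f y) = adj x y.

Lemma embeds_induced (H G : sgraph) : embeds H G -> induced_subgraph H G.
Proof.
case=> f f_inj f_adj; pose S := [set f x | x : H].
have fS x : f x \in S by apply: imset_f.
exists S; exists (fun x => Sub (f x) (fS x) : induced S); last first.
  by move=> x y; apply: f_adj.
apply: inj_card_bij => [x y /(congr1 val)|]; first exact: f_inj.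
by rewrite card_sig card_imset.
Qed.

Lemma induced_embeds (H G : sgraph) : induced_subgraph H G -> embeds H G.
Proof.
case=> S [f /bij_inj f_inj f_adj]; exists (val \o f) => //.
exact: inj_comp val_inj f_inj.
Qed.

Lemma embeds_trans (G2 G1 G3 : sgraph) :
  embeds G1 G2 -> embeds G2 G3 -> embeds G1 G3.
Proof.
case=> f f_inj f_adj [g g_inj g_adj]; exists (g \o f); first exact: inj_comp.
by move=> x y /=; rewrite g_adj f_adj.
Qed.

(** * Connectedness *)

Lemma connected_closed (G : sgraph) (X : {pred G}) :
  connected G -> (forall x y, adj x y -> x \in X -> y \in X) ->
  forall x y, x \in X -> y \in X.
Proof.
case=> _ G_conn X_closed x y xX.
have X_cl : closed (@adj G) X.
  by apply: intro_closed => //; apply: sym_connect_sym; apply: adj_sym.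
by rewrite -(closed_connect X_cl (G_conn x y)).
Qed.

Definition avoiding (G : sgraph) (X : {set G}) : rel G :=
  [rel x y | [&& adj x y, x \notin X & y \notin X]].

Lemma connected_induced (G : sgraph) (X : {set G}) (r : G) :
  r \notin X -> (forall y, y \notin X -> connect (avoiding X) r y) ->
  connected (induced (~: X)).
Proof.
move=> rX r_conn.
have rX' : r \in ~: X by rewrite inE.
have lift_path (x y : G) (xX : x \in ~: X) (yX : y \in ~: X) :
    connect (avoiding X) x y ->
    connect (@adj (induced (~: X))) (Sub x xX) (Sub y yX).
  case/connectP=> p; elim: p x xX => [|z p IHp] x xX /=.
    move=> _ y_x; rewrite (_ : Sub y yX = Sub x xX) //.
    by apply: val_inj.
  case/andP=> /and3P[xz _ zX] zp y_last.
  have zX' : z \in ~: X by rewrite inE.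
  by apply: connect_trans (IHp z zX' zp y_last); apply: connect1.
split; first by apply/card_gt0P; exists (Sub r rX').
move=> [x xX] [y yX].
have sym : connect_sym (@adj (induced (~: X))).
  by apply: sym_connect_sym; apply: adj_sym.
apply: (@connect_trans _ _ (Sub r rX')); first rewrite sym.
  by apply: lift_path; apply: r_conn; rewrite inE in xX.
by apply: lift_path; apply: r_conn; rewrite inE in yX.
Qed.

(** The condition on [X] bounds it by one element, which treats the deletion of nothing and of one
    vertex alike. The target [r] may depend on [X]. *)
Lemma two_connectedI (G : sgraph) :
  2 < #|G| ->
  (forall X : {set G}, {in X &, forall x y, x = y} ->
     exists2 r, r \notin X & forall y, y \notin X -> connect (avoiding X) y r) ->
  k_connected 2 G.
Proof.
move=> G_gt2 G_conn; split=> // X; rewrite ltnS => /card_le1_eqP X1.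
have [|r rX r_conn] := G_conn X; first by move=> x y xX yX; apply: X1.
apply: (connected_induced rX) => y yX.
have sym : connect_sym (avoiding X).
  by apply: sym_connect_sym => x z; rewrite /avoiding /= adj_sym [(z \notin X) && _]andbC.
by rewrite sym; apply: r_conn.
Qed.

(** * Graphs without dominating cycles *)

Lemma cycle_exit (T : finType) (c : seq T) (X : pred T) (x y : T) :
  uniq c -> x \in c -> X x -> y \in c -> ~~ X y ->
  exists z, [/\ z \in c, X z & ~~ X (next c z)].
Proof.
move=> c_uniq xc Xx yc XNy.
have [|X_cl] := boolP [exists z in c, X z && ~~ X (next c z)].
  by case/exists_inP=> z zc /andP[Xz XNz]; exists z.
suff: X y by rewrite (negPf XNy).
have := yc; rewrite -(fconnect_cycle (cycle_next c_uniq) xc) => /iter_findex <-.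
have iter_c n : iter n (next c) x \in c by elim: n => //= n; rewrite mem_next.
elim: (findex _ _ _) => //= n Xn; apply: contraR X_cl => XNn.
by apply/exists_inP; exists (iter n (next c) x); rewrite ?iter_c ?Xn.
Qed.

(** Pigeonhole: the labels 0, 1, 2 mark parts separated by the vertices labelled 3. Each part
    contains an edge, so a dominating cycle meets all three, and it leaves a part only by stepping
    onto [u] or [v]. As [next] is injective, the three exits would need three cut vertices. *)
Lemma two_cut_no_dominating_cycle (G : sgraph) (lab : G -> nat) (u v : G) :
  (forall x y, adj x y -> [|| lab x == 3, lab y == 3 | lab x == lab y]) ->
  (forall x, lab x = 3 -> x = u \/ x = v) ->
  (forall i, i < 3 -> exists x y, [/\ adj x y, lab x = i & lab y = i]) ->
  ~ has_dominating_cycle G.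
Proof.
move=> lab_adj cut blobs [c [_ /andP[c_cyc c_uniq]] c_dom].
have meet i : i < 3 -> exists2 x, x \in c & lab x = i.
  case/blobs=> x [y [/c_dom /orP[xc|yc] lab_x lab_y]]; by [exists x | exists y].
have next_inj : injective (next c) := can_inj (prev_next c_uniq).
have exit i : i < 3 -> exists2 z, lab z = i & next c z = u \/ next c z = v.
  move=> i_lt3; have [x xc lab_x] := meet i i_lt3.
  have [y yc lab_y] : exists2 y, y \in c & lab y != i.
    (* The boolean [i == 0], read as a number, is a label below 3 other than [i]. *)
    have [|y yc y_lab] := meet (i == 0); first by case: i {i_lt3 lab_x} => [|[]].
    by exists y; rewrite ?y_lab //; case: i {i_lt3 lab_x y_lab} => [|[]].
  have [z [zc /eqP lab_z lab_nz]] :=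
    @cycle_exit _ c (fun t => lab t == i) x y c_uniq xc (introT eqP lab_x) yc lab_y.
  exists z => //; apply: cut; apply/eqP.
  have := lab_adj _ _ (next_cycle c_cyc zc).
  rewrite lab_z eq_sym [i == lab _]eq_sym (negPf lab_nz) orbF.
  by case/orP=> // /eqP E; move: i_lt3; rewrite -E.
have [z0 l0 n0] := exit 0 isT; have [z1 l1 n1] := exit 1 isT.
have [z2 l2 n2] := exit 2 isT.
have differ a b : lab a != lab b -> next c a <> next c b.
  by move=> lab_ab /next_inj E; rewrite E eqxx in lab_ab.
have d01 : next c z0 <> next c z1 by apply: differ; rewrite l0 l1.
have d02 : next c z0 <> next c z2 by apply: differ; rewrite l0 l2.
have d12 : next c z1 <> next c z2 by apply: differ; rewrite l1 l2.
by case: n0 n1 n2 d01 d02 d12 => -> [] -> [] ->.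
Qed.

(* A cycle meeting all three rows runs through each row from one of its two
   gates to the other, so successive rows are traversed in opposite directions;
   this is impossible for an odd number of rows. *)
Lemma prism_no_dominating_cycle (G : sgraph) (row kind : G -> nat) :
  (forall x, row x < 3) ->
  (forall x y, adj x y -> row x != row y -> kind x = kind y /\ kind x < 2) ->
  (forall x y, row x = row y -> kind x = kind y -> kind x < 2 -> x = y) ->
  (forall i, i < 3 ->
     exists x y, [/\ adj x y, row x = i, row y = i, 1 < kind x & 1 < kind y]) ->
  ~ has_dominating_cycle G.
Proof.
move=> row_lt3 cross gate_uniq blobs [c [_ /andP[c_cyc c_uniq]] c_dom].
have meet i : i < 3 -> exists x, [/\ x \in c, row x = i & 1 < kind x].
  case/blobs=> x [y [/c_dom /orP[xc|yc] rx ry kx ky]]; by [exists x | exists y].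
have meet' i : i < 3 -> exists2 y, y \in c & row y != i.
  move=> i_lt3; have [|y [yc y_row _]] := meet (i == 0); first by case: i {i_lt3} => [|[]].
  by exists y; rewrite ?y_row //; case: i {i_lt3 y_row} => [|[]].
have next_inj : injective (next c) := can_inj (prev_next c_uniq).
have next_adj x : x \in c -> adj x (next c x) := next_cycle c_cyc.
(* The cycle leaves row [i] only from the gate [q], and enters it from [w]. An edge between rows
   keeps the kind, so [kind q + kind w = 1] says that the entry gate differs from the exit gate. *)
have rows i : i < 3 -> exists q w, [/\ q \in c, w \in c & [/\
    row q = i, row w != i & row (next c w) = i] /\
    [/\ kind q + kind w = 1 & forall x, x \in c -> row x = i ->
       row (next c x) != i -> x = q]].
  move=> i_lt3.
  have [x [xc row_x kind_x]] := meet i i_lt3; have [y yc row_y] := meet' i i_lt3.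
  pose D t := (row t == i) && (1 < kind t).
  have Dx : D x by rewrite /D row_x eqxx.
  have DNy : ~~ D y by rewrite /D (negPf row_y).
  have [z [zc Dz DNz]] := cycle_exit c_uniq xc Dx yc DNy.
  have [p [pc]] := @cycle_exit _ c (predC D) y x c_uniq yc DNy xc (introT negPn Dx).
  rewrite /= negbK => DNp Dp.
  have [q [qc /eqP row_q row_nq]] :=
    @cycle_exit _ c (fun t => row t == i) x y c_uniq xc (introT eqP row_x) yc row_y.
  have [w [wc row_w]] :=
    @cycle_exit _ c (fun t => row t != i) y x c_uniq yc row_y xc
      (introT negPn (introT eqP row_x)).
  rewrite negbK => /eqP row_nw.
  have row_z : row z = i by case/andP: Dz => /eqP.
  (* Only gates have neighbours in other rows, so the interior is entered and left through gates of
     row [i]: here [p] on the way in and [next c z] on the way out. *)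
  have row_nz : row (next c z) = i.
    apply/eqP; apply: contraT => nz; have [|_] := cross _ _ (next_adj _ zc).
      by rewrite row_z eq_sym.
    by case/andP: Dz => _; clear; lia.
  have kind_nz : kind (next c z) < 2.
    by move: DNz; rewrite /D row_nz eqxx /= -leqNgt; clear; lia.
  have row_np : row (next c p) = i by case/andP: Dp => /eqP.
  have row_p : row p = i.
    apply/eqP; apply: contraT => np; have [|kp] := cross _ _ (next_adj _ pc).
      by rewrite row_np.
    by case/andP: Dp => _; rewrite -kp; clear; lia.
  have kind_p : kind p < 2 by move: DNp; rewrite /D row_p eqxx /= -leqNgt; clear; lia.
  have exitP t : t \in c -> row t = i -> row (next c t) != i -> kind t < 2 /\ kind t != kind p.
    move=> tc rt rnt; have [|_ kt] := cross _ _ (next_adj _ tc).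
      by rewrite rt eq_sym.
    split=> //; apply/eqP => ktp; have tp : t = p by apply: gate_uniq; rewrite ?rt ?row_p.
    by rewrite tp row_np eqxx in rnt.
  have [kq kqp] := exitP _ qc row_q row_nq.
  have [|kw kw2] := cross _ _ (next_adj _ wc); first by rewrite row_nw.
  have kzw : kind (next c z) != kind (next c w).
    apply/eqP=> kzw; have /next_inj zw : next c z = next c w.
      by apply: gate_uniq; rewrite ?row_nz ?row_nw.
    by rewrite -zw row_z eqxx in row_w.
  exists q, w; split=> //; split=> //; split; last first.
    move=> t tc rt /exitP[//|//|kt ktp]; apply: gate_uniq => //; first by rewrite rt.
    by move: kq kqp kt ktp kind_p; clear; lia.
  suff: kind q != kind w by move: kq kw kw2; clear; lia.
  apply/eqP=> kqw.
  have qw : q = next c w by apply: gate_uniq; rewrite ?row_nw // kqw.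
  (* If the entry gate were also the exit gate [q], the cycle could never leave [D] together with
     [p]: the gate reached from [D] would have to be [q], whose predecessor [w] lies outside the
     row. *)
  pose X t := D t || (t == p).
  have Xy : ~~ X y.
    by rewrite /X (negPf DNy) /=; apply: contraNneq row_y => ->; apply/eqP.
  have [|t [tc Xt XNt]] := @cycle_exit _ c X x y c_uniq xc _ yc Xy.
    by rewrite /X Dx.
  case/norP: XNt => DNt ntp; case/orP: Xt => [Dt|/eqP tp]; last first.
    by rewrite tp Dp in DNt.
  have rt : row t = i by case/andP: Dt => /eqP.
  have rnt : row (next c t) = i.
    apply/eqP; apply: contraT => nt; have [|_] := cross _ _ (next_adj _ tc).
      by rewrite rt eq_sym.
    by case/andP: Dt => _; clear; lia.
  have knt : kind (next c t) < 2.
    by move: DNt; rewrite /D rnt eqxx /= -leqNgt; clear; lia.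
  have [kt|kt] := eqVneq (kind (next c t)) (kind p).
    by move/eqP: ntp; apply; apply: gate_uniq; rewrite ?rnt ?row_p.
  have /next_inj tw : next c t = next c w.
    rewrite -qw; apply: gate_uniq; rewrite ?rnt ?row_q //.
    by move: knt kt kq kqp kind_p; clear; lia.
  by rewrite -tw rt eqxx in row_w.
have [q0 [w0 [q0c w0c [[rq0 rw0 rnw0] [k0 u0]]]]] := rows 0 isT.
have [q1 [w1 [q1c w1c [[rq1 rw1 rnw1] [k1 u1]]]]] := rows 1 isT.
have [q2 [w2 [q2c w2c [[rq2 rw2 rnw2] [k2 u2]]]]] := rows 2 isT.
have diff a b : row (next c a) != row (next c b) -> a <> b.
  by move=> ab E; rewrite E eqxx in ab.
have d01 : w0 <> w1 by apply: diff; rewrite rnw0 rnw1.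
have d02 : w0 <> w2 by apply: diff; rewrite rnw0 rnw2.
have d12 : w1 <> w2 by apply: diff; rewrite rnw1 rnw2.
have q_of w : w \in c -> row (next c w) != row w -> [\/ w = q0, w = q1 | w = q2].
  move=> wc; have := row_lt3 w; case rw: (row w) => [|[|[|//]]] _ rnw.
  - by constructor 1; apply: u0.
  - by constructor 2; apply: u1.
  - by constructor 3; apply: u2.
have w0q : [\/ w0 = q0, w0 = q1 | w0 = q2] by apply: q_of; rewrite // rnw0 eq_sym.
have w1q : [\/ w1 = q0, w1 = q1 | w1 = q2] by apply: q_of; rewrite // rnw1 eq_sym.
have w2q : [\/ w2 = q0, w2 = q1 | w2 = q2] by apply: q_of; rewrite // rnw2 eq_sym.
have n0 : w0 <> q0 by move=> E; rewrite E rq0 in rw0.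
have n1 : w1 <> q1 by move=> E; rewrite E rq1 in rw1.
have n2 : w2 <> q2 by move=> E; rewrite E rq2 in rw2.
(* The vertices [w0], [w1], [w2] are distinct exit gates, each of a row other than the one entered,
   so the rows follow each other in a 3-cycle. The kinds of the exit gates would alternate around
   it, which parity forbids. *)
case: w0q w1q w2q => E0 [] E1 [] E2 //;
  solve [by case: d01; rewrite E0 E1 | by case: d02; rewrite E0 E2
        | by case: d12; rewrite E1 E2
        | by move: k0 k1 k2; rewrite E0 E1 E2; clear; lia].
Qed.

(** * Graphs given by edge lists, and their blow-ups *)

Definition edge (E : seq (nat * nat)) : rel nat :=
  fun i j => ((i, j) \in E) || ((j, i) \in E).

Lemma edge_sym E : symmetric (edge E).
Proof. by move=> i j; rewrite /edge orbC. Qed.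

Section ListGraph.
Variables (n : nat) (E : seq (nat * nat)).

Definition list_adj : rel 'I_n := [rel i j : 'I_n | (i != j) && edge E i j].

Fact list_adj_sym : symmetric list_adj.
Proof. by move=> i j; rewrite /list_adj /= eq_sym edge_sym. Qed.

Fact list_adj_irrefl : irreflexive list_adj.
Proof. by move=> i; rewrite /list_adj /= eqxx. Qed.

Definition list_graph : sgraph := SGraph list_adj_sym list_adj_irrefl.
End ListGraph.

(* A scheme describes a graph up to the multiplicity of its twins.  Vertices of
   the blow-up are pairs of a type and the number of a copy; a type in [singles]
   has one copy, any other type has [m.+3] copies, which form a clique if there
   is a link [(t, t)] and an independent set otherwise. *)
Record scheme := Scheme {
  types : nat;
  singles : seq nat;
  links : seq (nat * nat)
}.

Section BlowUp.
Variables (F : scheme) (m : nat).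
Local Notation k := (types F).
Local Notation sg := (singles F).
Local Notation E := (links F).

(** Three copies at least: one repeated type then already gives the order above 2 required for
    2-connectedness, and it keeps a copy after any single deletion. *)
Definition blow_vertex : finType :=
  {p : 'I_k * 'I_m.+3 | (val p.1 \in sg) ==> (val p.2 == 0)}.

Definition typ (p : blow_vertex) : nat := (val p).1.

Definition blow_adj : rel blow_vertex :=
  [rel p q | (p != q) && edge E (typ p) (typ q)].

Fact blow_adj_sym : symmetric blow_adj.
Proof. by move=> i j; rewrite /blow_adj /= eq_sym edge_sym. Qed.

Fact blow_adj_irrefl : irreflexive blow_adj.
Proof. by move=> i; rewrite /blow_adj /= eqxx. Qed.

Definition blow_up : sgraph := SGraph blow_adj_sym blow_adj_irrefl.

Lemma typ_lt (p : blow_up) : typ p < k.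
Proof. exact: ltn_ord. Qed.

Lemma typ_single (p q : blow_up) : typ p = typ q -> typ p \in sg -> p = q.
Proof.
move: p q => [[t i] ti] [[t' i'] ti'] /val_inj /= tt' t_sg.
apply/val_inj; rewrite -tt' {}/typ /= in ti' t_sg *; congr (_, _); apply: val_inj.
by rewrite t_sg /= in ti ti'; rewrite /= (eqP ti) (eqP ti').
Qed.

Lemma blow_adjE (p q : blow_up) :
  adj p q = (p != q) && edge E (typ p) (typ q).
Proof. by []. Qed.

Lemma blow_copy t j : t < k -> j < m.+3 -> (t \in sg -> j = 0) ->
  exists2 p : blow_up, typ p = t & (val p).2 = j :> nat.
Proof.
move=> t_lt j_lt tj.
have P : (val (Ordinal t_lt, Ordinal j_lt).1 \in sg) ==>
         (val (Ordinal t_lt, Ordinal j_lt).2 == 0).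
  by apply/implyP => /tj /= ->.
by exists (Sub (Ordinal t_lt, Ordinal j_lt) P).
Qed.

Lemma card_blow_up t : t < k -> t \notin sg -> m.+3 <= #|blow_up|.
Proof.
move=> t_lt t_sg.
have P (j : 'I_m.+3) : (val (Ordinal t_lt, j).1 \in sg) ==> (val (Ordinal t_lt, j).2 == 0).
  by rewrite /= (negPf t_sg).
rewrite -[X in X <= _]card_ord.
rewrite -(@card_imset _ _ (fun j => Sub (Ordinal t_lt, j) (P j) : blow_up)); last first.
  by move=> j j' /(congr1 val) [].
exact: max_card.
Qed.

(** Searches for a walk of types with at most [d.+1] steps whose inner types avoid [s]. Every step
    changes the type, so the walk lifts to any surviving copies; [t = t'] is allowed because twins
    may have to be joined through a third vertex. *)
Fixpoint linked (s d : nat) (t t' : nat) : bool :=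
  (t != t') && edge E t t' ||
  (if d is d'.+1 then
     has (fun w => [&& w != s, w != t, edge E t w & linked s d' w t']) (iota 0 k)
   else false).

(** The value [s = k], which is no type, stands for deleting nothing or one copy of a repeated type:
    every type then survives. Otherwise [s] is the deleted single type. *)
Definition linked_avoiding_each : bool :=
  has (fun t => t \notin sg) (iota 0 k) &&
  all (fun s => all (fun t => all (fun t' =>
     [|| t == s, t' == s | linked s 3 t t']) (iota 0 k)) (iota 0 k)) (k :: sg).

Lemma two_connected_blow_up : linked_avoiding_each -> k_connected 2 blow_up.
Proof.
case/andP=> /hasP[t0 t0_lt t0_sg] /allP checks; rewrite mem_iota in t0_lt.
apply: two_connectedI; first exact: leq_trans _ (card_blow_up t0_lt t0_sg).
move=> X X1.
have [s s_mem [s_single s_out]] : exists2 s, s \in k :: sg &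
    (forall x, x \in X -> typ x \in sg -> typ x = s) /\
    (forall y, y \notin X -> typ y != s).
  have [/exists_inP[x xX x_sg]|no_single] := boolP [exists x in X, typ x \in sg].
    exists (typ x); first by rewrite inE x_sg orbT.
    split=> [y yX _|y yX]; first by rewrite (X1 _ _ yX xX).
    apply: contraNneq yX => yx; by rewrite (typ_single yx) // yx.
  exists k; first by rewrite inE eqxx.
  split=> [y yX y_sg|y _]; last by rewrite ltn_eqF ?typ_lt.
  by case/exists_inP: no_single; exists y.
have copy t : t < k -> t != s -> exists2 p : blow_up, p \notin X & typ p = t.
  move=> t_lt ts; have [t_sg|t_sg] := boolP (t \in sg).
    have [p pt _] := @blow_copy t 0 t_lt isT (fun=> erefl).
    exists p => //; apply: contra_neqN ts => pX.
    by rewrite -pt; apply: s_single; rewrite ?pt.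
  have [p pt p0] := @blow_copy t 0 t_lt isT (fun=> erefl).
  have [|q qt q1] := @blow_copy t 1 t_lt isT; first by rewrite (negPf t_sg).
  have [pX|pX] := boolP (p \in X); last by exists p.
  exists q => //; apply/negP => qX.
  by move: q1; rewrite (X1 _ _ qX pX) p0.
have reach d (y z : blow_up) : y \notin X -> z \notin X ->
    linked s d (typ y) (typ z) -> connect (avoiding X) y z.
  elim: d y => [|d IHd] y yX zX /= => [|/orP[]].
  - rewrite orbF => /andP[yz yzE]; apply: connect1; rewrite /avoiding /= yX zX.
    by rewrite /blow_adj /= yzE !andbT; apply: contraNneq yz => ->.
  - case/andP=> yz yzE; apply: connect1; rewrite /avoiding /= yX zX.
    by rewrite /blow_adj /= yzE !andbT; apply: contraNneq yz => ->.
  case/hasP=> w; rewrite mem_iota /= => w_lt /and4P[ws wy yw w_z].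
  have [p pX pw] := copy w w_lt ws; subst w.
  apply: connect_trans (IHd p pX zX w_z); apply: connect1.
  rewrite /avoiding /= yX pX /blow_adj /= yw !andbT.
  by apply: contraNneq wy => ->.
have [r rX] : exists r, r \notin X.
  have [p pt p0] := @blow_copy t0 0 t0_lt isT (fun=> erefl).
  have [|q qt q1] := @blow_copy t0 1 t0_lt isT; first by rewrite (negPf t0_sg).
  have [pX|pX] := boolP (p \in X); last by exists p.
  by exists q; apply/negP => qX; move: q1; rewrite (X1 _ _ qX pX) p0.
exists r => // y yX.
have in_k (x : blow_up) : typ x \in iota 0 k by rewrite mem_iota typ_lt.
have /allP/(_ _ (in_k y))/allP/(_ _ (in_k r)) := checks s s_mem.
by rewrite (negPf (s_out _ yX)) (negPf (s_out _ rX)); apply: reach.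
Qed.

(* A partial embedding is recorded by the types of its vertices, listed in [a]. *)
Section Search.
Variables (n : nat) (EP : seq (nat * nat)).

Definition fits (i t : nat) (a : seq nat) : bool :=
  all (fun j => let t' := nth 0 a j in
    ((t == t') ==> (t \notin sg)) && (edge E t' t == edge EP j i)) (iota 0 i).

Fixpoint free_search (d i : nat) (a : seq nat) : bool :=
  if d is d'.+1 then
    all (fun t => fits i t a ==> free_search d' i.+1 (rcons a t)) (iota 0 k)
  else false.

(** Adjacency of distinct vertices depends on their types alone, and two vertices share a type only
    if it is repeated. The search therefore does not involve [m], and one computation excludes the
    pattern from the blow-ups of all sizes. *)
Lemma free_searchP : free_search n 0 [::] -> ~ embeds (list_graph n EP) blow_up.
Proof.
move=> search [f f_inj f_adj].
pose a i := [seq typ (f j) | j <- take i (enum 'I_n)].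
suff never d i : d + i = n -> free_search d i (a i) -> False.
  by apply: (never n 0); rewrite ?addn0 // /a take0.
elim: d i => [//|d IHd] i di /allP a_search.
have i_lt : i < n by rewrite -di addSn ltnS leq_addl.
apply: (IHd i.+1); first by rewrite addnS -addSn.
have := a_search (typ (f (Ordinal i_lt))).
rewrite mem_iota /= typ_lt => /(_ isT) /implyP.
have -> : rcons (a i) (typ (f (Ordinal i_lt))) = a i.+1.
  rewrite /a (take_nth (Ordinal i_lt)) ?size_enum_ord // map_rcons.
  by congr (rcons _ (typ (f _))); apply: val_inj; rewrite /= nth_enum_ord.
apply; apply/allP => j; rewrite mem_iota /= => j_lt.
have j_lt' : j < n := ltn_trans j_lt i_lt.
have -> : nth 0 (a i) j = typ (f (Ordinal j_lt')).
  rewrite /a (nth_map (Ordinal i_lt)); last first.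
    by rewrite size_takel ?size_enum_ord // ltnW.
  by congr (typ (f _)); apply: val_inj; rewrite /= nth_take // nth_enum_ord.
have fij : f (Ordinal j_lt') != f (Ordinal i_lt).
  by rewrite (inj_eq f_inj) -val_eqE /= ltn_eqF.
apply/andP; split.
  apply/implyP => /eqP ij; apply: contra fij => i_sg; apply/eqP/esym.
  exact: typ_single.
have := f_adj (Ordinal j_lt') (Ordinal i_lt); rewrite blow_adjE fij /= => ->.
by rewrite /list_adj /= -val_eqE /= (ltn_eqF j_lt).
Qed.
End Search.

(** A certificate for [two_cut_no_dominating_cycle]: [lab] sends each type to its part, with 3 for
    the cut formed by [u] and [v], and [w] names an edge in each part. A link [(t, t)] counts as an
    edge only when [t] has several copies. *)
Definition blobs_check (lab : seq nat) (u v : nat) (w : seq (nat * nat)) : bool :=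
  [&& u < k, v < k, u \in sg, v \in sg,
   all (fun t => all (fun t' => edge E t t' ==>
     [|| nth 3 lab t == 3, nth 3 lab t' == 3 | nth 3 lab t == nth 3 lab t'])
     (iota 0 k)) (iota 0 k),
   all (fun t => (nth 3 lab t == 3) ==> (t \in [:: u; v])) (iota 0 k) &
   all (fun i => let: (t, t') := nth (0, 0) w i in
     [&& edge E t t', t < k, t' < k, nth 3 lab t == i, nth 3 lab t' == i &
      (t != t') || (t \notin sg)]) (iota 0 3)].

Lemma blow_up_edge t t' : edge E t t' -> t < k -> t' < k ->
  (t != t') || (t \notin sg) ->
  exists x y : blow_up, [/\ adj x y, typ x = t & typ y = t'].
Proof.
move=> tt' t_lt t'_lt ne.
have [x xt x0] := @blow_copy t 0 t_lt isT (fun=> erefl).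
have [y yt y1] :
    exists2 y : blow_up, typ y = t' & ((val y).2 = 1 :> nat) \/ (t' \in sg).
  have [t'_sg|t'_sg] := boolP (t' \in sg).
    by have [y ? _] := @blow_copy t' 0 t'_lt isT (fun=> erefl); exists y; auto.
  have [|y ? ?] := @blow_copy t' 1 t'_lt isT; last by exists y; auto.
  by rewrite (negPf t'_sg).
exists x, y; split=> //; rewrite blow_adjE xt yt tt' andbT.
apply/eqP => xy; rewrite -xy in yt y1; rewrite -xt -yt eqxx /= in ne.
by case: y1 => [|t_sg]; [rewrite x0 | rewrite -yt (negPf ne) in t_sg].
Qed.

Lemma blobs_no_dominating_cycle lab u v w :
  blobs_check lab u v w -> ~ has_dominating_cycle blow_up.
Proof.
case/and5P=> u_lt v_lt u_sg v_sg /and3P[/allP lab_adj /allP cut /allP blobs].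
have [x xu _] := @blow_copy u 0 u_lt isT (fun=> erefl).
have [y yv _] := @blow_copy v 0 v_lt isT (fun=> erefl).
have in_k (p : blow_up) : typ p \in iota 0 k by rewrite mem_iota typ_lt.
apply: (@two_cut_no_dominating_cycle blow_up (fun p => nth 3 lab (typ p)) x y).
- move=> p q; rewrite blow_adjE => /andP[_ pq].
  by have /allP/(_ _ (in_k q)) := lab_adj _ (in_k p); rewrite pq.
- move=> p /eqP lab_p; have := cut _ (in_k p).
  rewrite lab_p !inE => /orP[] /eqP pE; [left|right];
  by apply: typ_single; rewrite pE.
move=> i i_lt; have := blobs i; rewrite mem_iota => /(_ i_lt).
case: (nth _ w i) => t t' /and5P[tt' t_lt t'_lt /eqP lab_t /andP[/eqP lab_t' ne]].
have [p [q [pq pt qt]]] := blow_up_edge tt' t_lt t'_lt ne.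
by exists p, q; rewrite pt qt.
Qed.

End BlowUp.

(** * Families of large graphs *)

(* Types [i], [3 + i] and [6 + i] are the two gates and the interior of row [i]. *)
Definition prism_check (F : scheme) : bool :=
  [&& all (fun t => all (fun t' => edge (links F) t t' ==>
       (t %% 3 == t' %% 3) || ((t %/ 3 == t' %/ 3) && (t %/ 3 < 2)))
       (iota 0 (types F))) (iota 0 (types F)),
      all (fun t => (t %/ 3 < 2) ==> (t \in singles F)) (iota 0 (types F)) &
      all (fun t => [&& t < types F, edge (links F) t t & t \notin singles F])
        [:: 6; 7; 8]].

Lemma prism_check_no_dominating_cycle (F : scheme) (m : nat) :
  prism_check F -> ~ has_dominating_cycle (blow_up F m).
Proof.
case/and3P=> /allP row_kind /allP gates /allP blobs.
have in_types (p : blow_up F m) : typ p \in iota 0 (types F).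
  by rewrite mem_iota typ_lt.
apply: (@prism_no_dominating_cycle (blow_up F m)
  (fun p => typ p %% 3) (fun p => typ p %/ 3)).
- by move=> p; rewrite ltn_mod.
- move=> p q; rewrite blow_adjE => /andP[_ pq] ne.
  have /allP/(_ _ (in_types q)) := row_kind _ (in_types p).
  by rewrite pq (negPf ne) /= => /andP[/eqP].
- move=> p q row_pq kind_pq kind_p; apply: typ_single.
    by rewrite (divn_eq (typ p) 3) row_pq kind_pq -divn_eq.
  by have := gates _ (in_types p); rewrite kind_p.
move=> i i_lt; have := blobs (6 + i).
have -> : 6 + i \in [:: 6; 7; 8] by case: i i_lt => [|[|[]]].
case/(_ isT)/and3P=> t_lt t_loop t_sg.
have [|p [q [pq pt qt]]] := blow_up_edge m t_loop t_lt t_lt; first by rewrite t_sg orbT.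
exists p, q; rewrite pt qt; split=> //; by case: i i_lt {t_lt t_loop t_sg pt qt} => [|[|[]]].
Qed.

(** * Pairs of graphs forced by the absence of a dominating cycle *)

Definition forces (A B : sgraph) : Prop :=
  exists n0, forall G : sgraph, k_connected 2 G -> n0 <= #|G| ->
    ~ has_dominating_cycle G -> embeds A G \/ embeds B G.

Lemma forces_sym A B : forces A B -> forces B A.
Proof.
case=> n0 AB; exists n0 => G G_conn G_large G_dom.
by case: (AB G G_conn G_large G_dom); [right | left].
Qed.

Lemma no_pattern (A G : sgraph) n E :
  embeds (list_graph n E) A -> ~ embeds (list_graph n E) G -> ~ embeds A G.
Proof. by move=> EA EG AG; apply: EG; apply: embeds_trans EA AG. Qed.

(** A pattern of [A] that the blow-ups avoid keeps [A] out of them, so [B] must occur. The choice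
    [m := n0] makes the blow-up large enough. *)
Lemma forces_blow_up (F : scheme) (A B : sgraph) n EP :
  linked_avoiding_each F -> (forall m, ~ has_dominating_cycle (blow_up F m)) ->
  free_search F EP n 0 [::] ->
  forces A B -> embeds (list_graph n EP) A -> exists m, embeds B (blow_up F m).
Proof.
move=> F_linked F_dom F_free [n0 AB] PA; exists n0.
have [||//|AF|//] := AB (blow_up F n0); first exact: two_connected_blow_up.
  case/andP: (F_linked) => /hasP[t]; rewrite mem_iota => t_lt t_sg _.
  by apply: leq_trans _ (card_blow_up n0 t_lt t_sg); rewrite -addn3 leq_addr.
by case: (no_pattern PA _ AF); apply: free_searchP.
Qed.

(** * Patterns and schemes *)

Definition K3 := list_graph 3 [:: (0, 1); (0, 2); (1, 2)].
Definition K4 := list_graph 4 [:: (0, 1); (0, 2); (0, 3); (1, 2); (1, 3); (2, 3)].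
Definition C4 := list_graph 4 [:: (0, 1); (1, 2); (2, 3); (3, 0)].
Definition P3 := list_graph 3 [:: (0, 1); (0, 2)].
Definition P4 := list_graph 4 [:: (0, 1); (1, 2); (2, 3)].
Definition P5 := list_graph 5 [:: (0, 1); (1, 2); (2, 3); (3, 4)].
Definition P6 := list_graph 6 [:: (0, 1); (1, 2); (2, 3); (3, 4); (4, 5)].
Definition independent4 := list_graph 4 [::].
Definition star3 := list_graph 4 [:: (0, 1); (0, 2); (0, 3)].
Definition spider113 := list_graph 6 [:: (0, 1); (0, 2); (0, 3); (3, 4); (4, 5)].
Definition bull22 := list_graph 7
  [:: (0, 1); (0, 2); (1, 2); (0, 3); (3, 4); (1, 5); (5, 6)].
Definition windmill := list_graph 7
  [:: (0, 1); (0, 2); (0, 3); (0, 4); (0, 5); (0, 6); (1, 2); (3, 4); (5, 6)].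

(** The graph K_2 + 3K_m. Common neighbours of two non-adjacent vertices are the two adjacent cut
    vertices, so there is no induced C_4. *)
Definition cliques_over_K2 := Scheme 5 [:: 0; 1]
  [:: (0, 1); (2, 2); (3, 3); (4, 4); (0, 2); (0, 3); (0, 4); (1, 2); (1, 3); (1, 4)].

(** The graph 2K_1 + 3K_m, whose induced subgraphs are classified to find [B]. *)
Definition cliques_over_2K1 := Scheme 5 [:: 0; 1]
  [:: (2, 2); (3, 3); (4, 4); (0, 2); (0, 3); (0, 4); (1, 2); (1, 3); (1, 4)].

(** The graph 2K_1 + 3K_{1,m} with star centres [2], [3], [4]. A clique has at most one cut vertex
    and two vertices of a star, so there is no K_4. *)
Definition stars_over_2K1 := Scheme 8 [:: 0; 1; 2; 3; 4]
  [:: (2, 5); (3, 6); (4, 7);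
      (0, 2); (0, 3); (0, 4); (0, 5); (0, 6); (0, 7);
      (1, 2); (1, 3); (1, 4); (1, 5); (1, 6); (1, 7)].

(** Here the cut vertices see only the leaves of the stars. The graph is bipartite, with the leaves
    on one side, hence triangle-free. *)
Definition leaves_over_2K1 := Scheme 8 [:: 0; 1; 2; 3; 4]
  [:: (2, 5); (3, 6); (4, 7);
      (0, 5); (0, 6); (0, 7); (1, 5); (1, 6); (1, 7)].

(* Of the three components left by the cut [0, 1], each cut vertex sees one only
   in part, which rules out a windmill centred at it. *)
Definition windmill_free := Scheme 7 [:: 0; 1; 2; 3; 4; 5]
  [:: (0, 1); (2, 3); (4, 5); (6, 6);
      (0, 2); (0, 4); (0, 5); (0, 6); (1, 2); (1, 3); (1, 4); (1, 6)].

(** Each row forms a clique with its two gates, so three cliques cover the graph and no four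
    vertices are independent. *)
Definition clique_prism := Scheme 9 [:: 0; 1; 2; 3; 4; 5]
  [:: (0, 1); (0, 2); (1, 2); (3, 4); (3, 5); (4, 5);
      (6, 6); (7, 7); (8, 8); (0, 6); (1, 7); (2, 8); (3, 6); (4, 7); (5, 8);
      (0, 3); (1, 4); (2, 5)].

(* The two gates of a row are non-adjacent, so that no triangle meets a gate, an
   interior vertex and the other gate. *)
Definition diamond_prism := Scheme 9 [:: 0; 1; 2; 3; 4; 5]
  [:: (0, 1); (0, 2); (1, 2); (3, 4); (3, 5); (4, 5);
      (6, 6); (7, 7); (8, 8); (0, 6); (1, 7); (2, 8); (3, 6); (4, 7); (5, 8)].

Section Forced.
Variables A B : sgraph.
Hypothesis AB : forces A B.

Lemma P4_forces_cliques_over_K2 :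
  embeds P4 A -> exists m, embeds B (blow_up cliques_over_K2 m).
Proof.
apply: forces_blow_up AB => // m.
exact: (@blobs_no_dominating_cycle _ _ [:: 3; 3; 0; 1; 2] 0 1 [:: (2, 2); (3, 3); (4, 4)]).
Qed.

Lemma P4_forces_cliques_over_2K1 :
  embeds P4 A -> exists m, embeds B (blow_up cliques_over_2K1 m).
Proof.
apply: forces_blow_up AB => // m.
exact: (@blobs_no_dominating_cycle _ _ [:: 3; 3; 0; 1; 2] 0 1 [:: (2, 2); (3, 3); (4, 4)]).
Qed.

Lemma P4_forces_stars_over_2K1 :
  embeds P4 A -> exists m, embeds B (blow_up stars_over_2K1 m).
Proof.
apply: forces_blow_up AB => // m.
exact: (@blobs_no_dominating_cycle _ _ [:: 3; 3; 0; 1; 2; 0; 1; 2] 0 1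
  [:: (2, 5); (3, 6); (4, 7)]).
Qed.

Lemma leaves_over_2K1_no_dominating_cycle m :
  ~ has_dominating_cycle (blow_up leaves_over_2K1 m).
Proof.
exact: (@blobs_no_dominating_cycle _ _ [:: 3; 3; 0; 1; 2; 0; 1; 2] 0 1
  [:: (2, 5); (3, 6); (4, 7)]).
Qed.

Lemma P6_forces_leaves_over_2K1 :
  embeds P6 A -> exists m, embeds B (blow_up leaves_over_2K1 m).
Proof. by apply: forces_blow_up AB => //; apply: leaves_over_2K1_no_dominating_cycle. Qed.

Lemma spider113_forces_leaves_over_2K1 :
  embeds spider113 A -> exists m, embeds B (blow_up leaves_over_2K1 m).
Proof. by apply: forces_blow_up AB => //; apply: leaves_over_2K1_no_dominating_cycle. Qed.

Lemma P5_forces_windmill_free :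
  embeds P5 A -> exists m, embeds B (blow_up windmill_free m).
Proof.
apply: forces_blow_up AB => // m.
exact: (@blobs_no_dominating_cycle _ _ [:: 3; 3; 0; 0; 1; 1; 2] 0 1
  [:: (2, 3); (4, 5); (6, 6)]).
Qed.

Lemma star3_forces_clique_prism :
  embeds star3 A -> exists m, embeds B (blow_up clique_prism m).
Proof.
by apply: forces_blow_up AB => // m; apply: prism_check_no_dominating_cycle.
Qed.

Lemma independent4_forces_clique_prism :
  embeds independent4 A -> exists m, embeds B (blow_up clique_prism m).
Proof.
by apply: forces_blow_up AB => // m; apply: prism_check_no_dominating_cycle.
Qed.

Lemma star3_forces_diamond_prism :
  embeds star3 A -> exists m, embeds B (blow_up diamond_prism m).
Proof.
by apply: forces_blow_up AB => // m; apply: prism_check_no_dominating_cycle.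
Qed.

End Forced.

Lemma C4_free_cliques_over_K2 m : ~ embeds C4 (blow_up cliques_over_K2 m).
Proof. exact: free_searchP. Qed.

Lemma K4_free_stars_over_2K1 m : ~ embeds K4 (blow_up stars_over_2K1 m).
Proof. exact: free_searchP. Qed.

Lemma P4_free_cliques_over_K2 m : ~ embeds P4 (blow_up cliques_over_K2 m).
Proof. exact: free_searchP. Qed.

Lemma K3_free_leaves_over_2K1 m : ~ embeds K3 (blow_up leaves_over_2K1 m).
Proof. exact: free_searchP. Qed.

Lemma windmill_free_free m : ~ embeds windmill (blow_up windmill_free m).
Proof. exact: free_searchP. Qed.

Lemma star3_free_clique_prism m : ~ embeds star3 (blow_up clique_prism m).
Proof. exact: free_searchP. Qed.

Lemma independent4_free_clique_prism m : ~ embeds independent4 (blow_up clique_prism m).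
Proof. exact: free_searchP. Qed.

Lemma bull22_free_diamond_prism m : ~ embeds bull22 (blow_up diamond_prism m).
Proof. exact: free_searchP. Qed.

(** * Long theta graphs and prisms *)

(* Three paths of order [n.+4]; [cross b i j] tells which of their ends are
   joined: those of path 0 to the two others in the theta graph, and all pairs
   in the prism. *)
Definition cross (b : bool) (i j : nat) : bool := [|| b, i == 0 | j == 0].

Section Ladder.
Variables (b : bool) (n : nat).

Definition ladder_adj : rel ('I_3 * 'I_n.+4)%type := fun x y =>
  if x.1 == y.1 :> nat then (x.2.+1 == y.2) || (y.2.+1 == x.2)
  else [&& x.2 == y.2 :> nat, (x.2 == 0 :> nat) || (x.2 == n.+3 :> nat) & cross b x.1 y.1].

Fact ladder_sym : symmetric ladder_adj.
Proof.
move=> x y; rewrite /ladder_adj eq_sym orbC /cross [(nat_of_ord x.1 == 0) || _]orbC.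
by case: (nat_of_ord y.1 == nat_of_ord x.1) => //; rewrite eq_sym; case: eqP => // ->.
Qed.

Fact ladder_irrefl : irreflexive ladder_adj.
Proof. by move=> x; rewrite /ladder_adj eqxx orbb gtn_eqF. Qed.

Definition ladder : sgraph := SGraph ladder_sym ladder_irrefl.

Definition rung (i t : nat) : ladder := (inord i, inord t).

Lemma rungE (x : ladder) : x = rung x.1 x.2.
Proof. by case: x => i t; rewrite /rung !inord_val. Qed.

Lemma rung1 i t : i < 3 -> (rung i t).1 = i :> nat.
Proof. exact: inordK. Qed.

Lemma rung2 i t : t < n.+4 -> (rung i t).2 = t :> nat.
Proof. exact: inordK. Qed.

Lemma rung_inj i t j s : i < 3 -> t < n.+4 -> j < 3 -> s < n.+4 ->
  rung i t = rung j s -> i = j /\ t = s.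
Proof.
move=> i_lt t_lt j_lt s_lt E.
by split; [rewrite -(rung1 t i_lt) E rung1 | rewrite -(rung2 i t_lt) E rung2].
Qed.

Lemma two_connected_ladder : k_connected 2 ladder.
Proof.
apply: two_connectedI.
  by rewrite card_prod !card_ord mulSn; apply: leq_trans (leq_addr _ _).
move=> X X1.
have conn_sym : connect_sym (avoiding X).
  by apply: sym_connect_sym => x z; rewrite /avoiding /= ladder_sym [(z \notin X) && _]andbC.
have along i s t : i < 3 -> s <= t -> t < n.+4 ->
    (forall r, s <= r <= t -> rung i r \notin X) ->
    connect (avoiding X) (rung i s) (rung i t).
  move=> i_lt; elim: t => [|t IHt] st t_lt out.
    by move: st; rewrite leqn0 => /eqP ->.
  have [->//|ne] := eqVneq s t.+1.
  have st' : s <= t by rewrite -ltnS ltn_neqAle ne.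
  apply: connect_trans (IHt st' (ltnW t_lt) _) _.
    by move=> r /andP[sr rt]; apply: out; rewrite sr ltnW.
  apply: connect1; rewrite /avoiding /= !out ?leqnn ?st' ?leqnSn ?st //.
  by rewrite /ladder_adj !rung1 ?rung2 ?eqxx // ltnW.
have across i t : i < 3 -> (t = 0) \/ (t = n.+3) ->
    rung i t \notin X -> rung 0 t \notin X ->
    connect (avoiding X) (rung i t) (rung 0 t).
  move=> i_lt t_end iX zX; have [->//|i0] := eqVneq i 0.
  have t_lt : t < n.+4 by case: t_end => ->.
  apply: connect1; rewrite /avoiding /= iX zX /ladder_adj !rung1 ?rung2 //.
  by rewrite (negPf i0) eqxx /cross eqxx !orbT; case: t_end => ->; rewrite eqxx ?orbT.
(* The target is one end of path 0, or its other end when the first is deleted. *)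
have [X00|X00] := boolP (rung 0 0 \in X).
  have out i t : i < 3 -> t < n.+4 -> 0 < i + t -> rung i t \notin X.
    move=> i_lt t_lt it; apply/negP => /(X1 _ _ X00) /rung_inj [] // i0 t0.
    by rewrite -i0 -t0 in it.
  exists (rung 0 n.+3); first exact: out.
  move=> y; rewrite (rungE y); move: (ltn_ord y.1) (ltn_ord y.2).
  move: (nat_of_ord y.1) (nat_of_ord y.2) => i t i_lt t_lt itX.
  have it : 0 < i + t.
    rewrite lt0n; apply: contraNneq itX => /eqP; rewrite addn_eq0.
    by case/andP=> /eqP-> /eqP->.
  apply: (@connect_trans _ _ (rung i n.+3)).
    apply: along => // r /andP[tr rn]; apply: out => //.
    by apply: leq_trans it _; rewrite leq_add2l.
  by apply: across => //; [right | apply: out; rewrite ?addnS | apply: out].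
exists (rung 0 0) => // y; rewrite (rungE y); move: (ltn_ord y.1) (ltn_ord y.2).
move: (nat_of_ord y.1) (nat_of_ord y.2) => i t i_lt t_lt itX.
(* A deleted vertex below [rung i t] forces a detour: up path [i], through the far end of path 0 to
   a path [j] other than [i], and down path [j]. *)
have [/existsP[r /andP[rt rX]]|down] := boolP [exists r : 'I_t, (r < t) && (rung i r \in X)].
  have out j s : j < 3 -> s < n.+4 -> (j != i) || (s != r) -> rung j s \notin X.
    move=> j_lt s_lt ne; apply/negP => /(X1 _ _ rX) /rung_inj [] //.
      exact: ltn_trans rt t_lt.
    by move=> ij rs; rewrite ij rs !eqxx in ne.
  have [j j_lt ji] : exists2 j, j < 3 & j != i.
    by exists (i == 0); case: (i).
  have r_ne s : t <= s -> s != r by move=> ts; rewrite gtn_eqF // (leq_trans rt).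
  apply: (@connect_trans _ _ (rung i n.+3)).
    by apply: along => // s /andP[ts sn]; apply: out; rewrite // r_ne ?orbT.
  apply: (@connect_trans _ _ (rung 0 n.+3)).
    by apply: across => //; [right | apply: out | apply: out]; rewrite // r_ne ?orbT // -ltnS.
  apply: (@connect_trans _ _ (rung j n.+3)).
    rewrite conn_sym; apply: across => //; [by right | by apply: out; rewrite ?ji |].
    by apply: out; rewrite // r_ne ?orbT // -ltnS.
  apply: (@connect_trans _ _ (rung j 0)).
    by rewrite conn_sym; apply: along => // s /andP[_ sn]; apply: out; rewrite ?ji.
  by apply: across => //; [left | apply: out; rewrite ?ji].
have out r : r <= t -> rung i r \notin X.
  rewrite leq_eqVlt => /orP[/eqP->//|rt]; apply: contra down => rX.
  by apply/existsP; exists (Ordinal rt); rewrite rt.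
apply: (@connect_trans _ _ (rung i 0)).
  by rewrite conn_sym; apply: along => // s /andP[_]; apply: out.
by apply: across => //; [left | apply: out].
Qed.

Lemma card_ladder : n <= #|ladder|.
Proof.
by rewrite card_prod !card_ord mulSn -addn4 -addnA leq_addr.
Qed.

(** Order at least four leaves every path an edge between interior vertices, which a dominating
    cycle has to meet. *)
Lemma ladder_path_edge i : i < 3 ->
  adj (rung i 1) (rung i 2).
Proof. by move=> i_lt; rewrite /= /ladder_adj !rung1 // eqxx !rung2. Qed.

End Ladder.

(** The ends of path 0 are the branch vertices; they separate its interior, path 1 and path 2. *)
Lemma theta_no_dominating_cycle n : ~ has_dominating_cycle (ladder false n).
Proof.
pose pole t := (t == 0) || (t == n.+3).
pose lab (x : ladder false n) :=
  if nat_of_ord x.1 == 0 then if pole x.2 then 3 else 0 else x.1 : nat.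
apply: (@two_cut_no_dominating_cycle _ lab (rung _ _ 0 0) (rung _ _ 0 n.+3)).
- move=> x y; rewrite /= /ladder_adj /lab /cross /pole.
  case: (eqVneq (nat_of_ord x.1) (nat_of_ord y.1)) => [->|xy].
    by case: (nat_of_ord y.1 == 0) => _; rewrite ?eqxx ?orbT //;
      do 2?case: ifP; rewrite ?eqxx ?orbT.
  by case/and3P=> /eqP-> -> /= /orP[]->; rewrite ?orbT.
- move=> x; rewrite /lab; case: eqP => [x0|_ x3]; last first.
    by have := ltn_ord x.1; rewrite x3.
  by case: ifP => // /orP[] /eqP xt _; [left|right]; rewrite (rungE x) x0 xt.
move=> i i_lt; exists (rung _ _ i 1), (rung _ _ i 2).
split; first exact: ladder_path_edge.
  by rewrite /lab rung1 // /pole rung2 //; case: eqP => [->|].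
by rewrite /lab rung1 // /pole rung2 //; case: eqP => [->|].
Qed.

Lemma prism_ladder_no_dominating_cycle n : ~ has_dominating_cycle (ladder true n).
Proof.
pose kind (x : ladder true n) :=
  if nat_of_ord x.2 == 0 then 0 else if nat_of_ord x.2 == n.+3 then 1 else 2.
apply: (@prism_no_dominating_cycle (ladder true n) (fun x => nat_of_ord x.1) kind).
- by move=> x; apply: ltn_ord.
- move=> x y; rewrite /= /ladder_adj => xy ne; move: xy; rewrite (negPf ne).
  rewrite /kind; case/and3P=> /eqP<- x_end _; split=> //.
  by case/orP: x_end => -> //; case: ifP.
- move=> x y x1 xy kx; apply: injective_projections; apply: val_inj => //.
  move: xy kx; rewrite /kind /=; move: (nat_of_ord x.2) (nat_of_ord y.2).
  by clear=> t s; do 4?[case: eqP => [->|_]].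
move=> i i_lt; exists (rung _ _ i 1), (rung _ _ i 2).
by rewrite /kind !rung1 ?rung2 //; split=> //; apply: ladder_path_edge.
Qed.

Lemma star3_free_prism_ladder n : ~ embeds star3 (ladder true n).
Proof.
case=> f f_inj f_adj.
pose c := f ord0; pose leaf i := f (inord i : 'I_4).
have c_leaf i : 0 < i < 4 -> ladder_adj true c (leaf i).
  move=> i_lt; rewrite -[ladder_adj _ _ _]/(@adj (ladder true n) c (leaf i)).
  rewrite f_adj /= /list_adj /= -val_eqE /= inordK; last by case/andP: i_lt.
  by case: i i_lt => [|[|[|[]]]].
have leaf_leaf i j : 0 < i < 4 -> 0 < j < 4 -> i != j ->
    ~~ ladder_adj true (leaf i) (leaf j) /\ leaf i <> leaf j.
  move=> /andP[i_gt i_lt] /andP[j_gt j_lt] ij; split; last first.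
    by move/f_inj/(congr1 val); rewrite /= !inordK // => /eqP; apply/negP.
  rewrite -[ladder_adj _ _ _]/(@adj (ladder true n) (leaf i) (leaf j)).
  rewrite f_adj /= /list_adj /= -val_eqE /= !inordK //.
  by case: i i_gt i_lt ij => [|[|[|[]]]] //; case: j j_gt j_lt => [|[|[|[]]]].
(* The neighbourhood of a vertex is covered by two cliques. *)
pose side (y : ladder true n) := (y.2 < c.2) || ((y.1 != c.1 :> nat) && (c.2 == 0 :> nat)).
have same_side y z : ladder_adj true c y -> ladder_adj true c z ->
    side y = side z -> ~~ ladder_adj true y z -> y = z.
  move=> cy cz s_yz yz; suff [] : y.1 = z.1 :> nat /\ y.2 = z.2 :> nat.
    by case: y z {cy cz s_yz yz} => [? ?] [? ?] /= /val_inj -> /val_inj ->.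
  move: cy cz s_yz yz; rewrite /side /ladder_adj /cross.
  move: (ltn_ord c.2) (ltn_ord y.2) (ltn_ord z.2).
  move: (nat_of_ord c.1) (nat_of_ord c.2) (nat_of_ord y.1) (nat_of_ord y.2).
  move: (nat_of_ord z.1) (nat_of_ord z.2).
  clear; move=> z1 z2 c1 c2 y1 y2.
  case: (eqVneq c1 y1) => cy; case: (eqVneq c1 z1) => cz; case: (eqVneq y1 z1) => yz; lia.
have pick i j : 0 < i < 4 -> 0 < j < 4 -> i != j -> side (leaf i) != side (leaf j).
  move=> i_lt j_lt ij; have [nadj ne] := leaf_leaf i j i_lt j_lt ij.
  by apply/eqP => /same_side E; apply/ne/E; rewrite ?c_leaf.
have := pick 1 2 isT isT isT; have := pick 1 3 isT isT isT.
by have := pick 2 3 isT isT isT; do 3!case: (side _).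
Qed.

(** The bounds on the orders ensure that an embedded copy misses a vertex of each path. *)
Lemma forces_ladder b (A B : sgraph) : forces A B ->
  exists n, [/\ #|A| <= n, #|B| <= n & embeds A (ladder b n) \/ embeds B (ladder b n)].
Proof.
case=> n0 AB; pose n := n0 + #|A| + #|B|.
exists n; split; rewrite ?leq_addl //.
  exact: leq_trans (leq_addl _ _) (leq_addr _ _).
apply: AB; first exact: two_connected_ladder.
  by apply: leq_trans (card_ladder b n); rewrite /n -addnA leq_addr.
by case: b; [apply: prism_ladder_no_dominating_cycle | apply: theta_no_dominating_cycle].
Qed.

(** * Spiders and nets *)

(* The neighbourhood of one end of a ladder, unrolled to three infinite legs: an
   infinite spider with centre [(0, 0)], or an infinite net. *)
Definition net_adj (b : bool) : rel (nat * nat) := fun p q =>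
  if p.1 == q.1 then (p.2.+1 == q.2) || (q.2.+1 == p.2)
  else [&& p.2 == 0, q.2 == 0 & cross b p.1 q.1].

(** The numbers [l 0], [l 1], [l 2] determine [B] up to isomorphism. In a spider leg 0 includes the
    centre, so its legs proper have [l 0 - 1], [l 1], [l 2] vertices; in a net each leg includes its
    triangle vertex. *)
Definition legged (b : bool) (B : sgraph) (l : nat -> nat) : Prop :=
  exists g : B -> nat * nat, [/\ injective g,
    forall x y, adj x y = net_adj b (g x) (g y) &
    forall p, (exists x, g x = p) <-> (p.1 < 3 /\ p.2 < l p.1)].

(** Choose a level [h i] missed on each path [i]. These holes separate the two ends of the ladder,
    so the connected graph [B] lies entirely below or entirely above them; in the second case the
    levels are reversed. *)
Lemma ladder_unroll b n (B : sgraph) :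
  connected B -> #|B| <= n -> embeds B (ladder b n) ->
  exists g : B -> nat * nat, [/\ injective g,
    forall x y, adj x y = net_adj b (g x) (g y) & forall x, (g x).1 < 3].
Proof.
move=> B_conn B_le [f f_inj f_adj].
have hole (i : 'I_3) : exists t : 'I_n.+4, forall x, (f x).1 = i -> (f x).2 != t.
  pose S := [set (f x).2 | x in [set x : B | (f x).1 == i]].
  have [t tS] : exists t, t \notin S.
    apply/existsP; rewrite -negb_forall; apply/negP => /forallP S_full.
    have : #|'I_n.+4| <= #|S| by apply/subset_leq_card/subsetP => t _; apply: S_full.
    have : #|S| <= n.
      by apply: leq_trans (leq_imset_card _ _) _; apply: leq_trans (max_card _) B_le.
    by rewrite card_ord; clear; lia.
  exists t => x xi; apply: contraNneq tS => <-; apply: imset_f.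
  by rewrite inE xi.
have [h hP] := fin_all_exists hole.
have h_ne x : nat_of_ord (f x).2 != h (f x).1 by apply: hP.
pose X := [pred x | (f x).2 < h (f x).1].
have X_closed x y : adj x y -> x \in X -> y \in X.
  rewrite -f_adj /= /ladder_adj !inE; have := h_ne x; have := h_ne y.
  case: (nat_of_ord (f x).1 =P (f y).1) => [/val_inj ->|_]; last move: (ltn_ord (h (f x).1)).
    by move: (nat_of_ord (f x).2) (nat_of_ord (f y).2) (nat_of_ord (h _)); clear; lia.
  move: (nat_of_ord (f x).2) (nat_of_ord (f y).2) (nat_of_ord (h _)) (nat_of_ord (h _)).
  by move: (cross _ _ _); clear=> -[] t s u v; lia.
have [/existsP[x0 x0X]|none] := boolP [exists x, x \in X].
  have below x : (f x).2 < h (f x).1 := connected_closed B_conn X_closed x x0X.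
  exists (fun x => (nat_of_ord (f x).1, nat_of_ord (f x).2)); split.
  - by move=> x y [/val_inj x1 /val_inj x2]; apply: f_inj; apply: injective_projections.
  - move=> x y; rewrite -f_adj /= /ladder_adj /net_adj /=; case: eqP => // _.
    have := below x; move: (ltn_ord (h (f x).1)).
    move: (nat_of_ord (h _)) (nat_of_ord (f x).2) (nat_of_ord (f y).2) (cross _ _ _).
    by clear=> u t s []; lia.
  by move=> x; apply: ltn_ord.
have above x : h (f x).1 < (f x).2.
  have := h_ne x; rewrite neq_ltn => /orP[x_lt|//].
  by case/existsP: none; exists x.
exists (fun x => (nat_of_ord (f x).1, n.+3 - (f x).2)); split.
- move=> x y [/val_inj x1 x2]; apply: f_inj; apply: injective_projections => //.
  apply: val_inj; move: x2 (ltn_ord (f x).2) (ltn_ord (f y).2) => /=; clear.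
  by move: (nat_of_ord (f x).2) (nat_of_ord (f y).2) => t s; lia.
- move=> x y; rewrite -f_adj /= /ladder_adj /net_adj /=.
  have := above x; have := above y; move: (ltn_ord (f x).2) (ltn_ord (f y).2).
  move: (nat_of_ord (h _)) (nat_of_ord (h _)) (nat_of_ord (f x).2) (nat_of_ord (f y).2).
  by move: (cross _ _ _); clear=> -[] u v t s; case: ifP => _; lia.
by move=> x; apply: ltn_ord.
Qed.

Lemma unrolled_legs b (B : sgraph) (g : B -> nat * nat) :
  injective g -> (forall x y, adj x y = net_adj b (g x) (g y)) ->
  (forall x, (g x).1 < 3) ->
  (forall x t, t <= (g x).2 -> exists z, g z = ((g x).1, t)) ->
  exists l, legged b B l.
Proof.
move=> g_inj g_adj g_row g_down.
exists (fun i => \max_(x | (g x).1 == i) (g x).2.+1), g; split=> // -[i t]; split=> /=.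
  case=> x gx; have := g_row x; rewrite gx; split=> //.
  by apply: leq_trans (leq_bigmax_cond _ (_ : (g x).1 == i)); rewrite gx ?eqxx.
case=> i_lt t_lt.
have [x /eqP xi tx] : exists2 x, (g x).1 == i & t < (g x).2.+1.
  apply/exists_inP; apply: contraLR t_lt; rewrite negb_exists_in -leqNgt => /forall_inP le.
  by apply/bigmax_leqP => x /le; rewrite -leqNgt.
by have [z gz] := g_down x t tx; exists z; rewrite gz xi.
Qed.

Lemma ladder_legs b n (B : sgraph) :
  connected B -> #|B| <= n -> embeds B (ladder b n) -> exists l, legged b B l.
Proof.
move=> B_conn B_le /(ladder_unroll B_conn B_le)[g [g_inj g_adj g_row]].
(* A gap at level [t] below [x] would cut [x] off from every [y] in another row or below [t]. *)
have between x y t : t <= (g x).2 -> ((g y).1 != (g x).1) || ((g y).2 < t) ->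
    exists z, g z = ((g x).1, t).
  move=> tx y_out.
  have [/existsP[z /eqP gz]|none] := boolP [exists z, g z == ((g x).1, t)]; first by exists z.
  have g_ne z : (g z).1 = (g x).1 -> (g z).2 != t.
    move=> z1; apply: contra none => /eqP z2; apply/existsP; exists z.
    by rewrite -z1 -z2 -surjective_pairing.
  pose X := [pred z | ((g z).1 == (g x).1) && (t < (g z).2)].
  have X_closed z z' : adj z z' -> z \in X -> z' \in X.
    rewrite g_adj /net_adj !inE => zz' /andP[/eqP z1 tz].
    move: zz' (g_ne z'); rewrite z1; case: eqP => [<-|_] zz'; last first.
      by case/andP: zz' => /eqP z0; rewrite z0 in tz.
    move/(_ erefl); rewrite eqxx; move: zz' tz; clear.
    by move: (g z).2 (g z').2 => s s'; lia.
  have xX : x \in X by rewrite inE eqxx /= ltn_neqAle tx andbT eq_sym g_ne.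
  have := connected_closed B_conn X_closed y xX; rewrite inE => /andP[/eqP y1].
  by move: y_out; rewrite y1 eqxx /=; clear; lia.
(* If two rows are met, each leg is filled down to level 0. A graph inside one row is a path that
   need not reach level 0, and it is shifted down. *)
have [/existsP[x0 /existsP[y0 xy]]|one_row] :=
    boolP [exists x, exists y, (g x).1 != (g y).1].
  apply: (@unrolled_legs b B g) => // x t tx.
  have [xx0|xx0] := eqVneq (g x0).1 (g x).1; last by apply: (between x x0); rewrite ?xx0.
  by apply: (between x y0) => //; rewrite -xx0 eq_sym xy.
have row_eq x y : (g x).1 = (g y).1.
  by apply/eqP; apply: contraNT one_row => xy; apply/existsP; exists x; apply/existsP; exists y.
have [x0 _] : exists x0 : B, true by case: B_conn => /card_gt0P[x0 _] _; exists x0.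
have [z0 _ z0_min] := arg_minnP (fun x => (g x).2) (isT : xpredT x0).
apply: (@unrolled_legs b B (fun x => ((g x).1, (g x).2 - (g z0).2))) => //=.
- move=> x y [x1 x2]; apply: g_inj; rewrite [g x]surjective_pairing x1 [g y]surjective_pairing.
  congr (_, _); move: (z0_min x isT) (z0_min y isT) x2; clear.
  by move: (g x).2 (g y).2 (g z0).2 => s s' s0; lia.
- move=> x y; rewrite g_adj /net_adj /= (row_eq x y) eqxx.
  move: (z0_min x isT) (z0_min y isT); clear.
  by move: (g x).2 (g y).2 (g z0).2 => s s' s0; lia.
move=> x [|t] tx.
  by exists z0; rewrite subnn (row_eq x z0).
have [|//|z gz] := between x z0 (t.+1 + (g z0).2).
- by rewrite addnC -leq_subRL ?z0_min // in tx *; move: (z0_min x isT) tx; clear; lia.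
- by rewrite addSn ltnS leq_addl orbT.
by exists z; rewrite gz addnK.
Qed.

Lemma legs_pattern b (B : sgraph) l n E (cs : seq (nat * nat)) :
  legged b B l -> size cs = n -> uniq cs ->
  all (fun i => all (fun j => (i == j) ||
    (net_adj b (nth (0, 0) cs i) (nth (0, 0) cs j) == edge E i j)) (iota 0 n)) (iota 0 n) ->
  all (fun p => (p.1 < 3) && (p.2 < l p.1)) cs -> embeds (list_graph n E) B.
Proof.
case=> g [g_inj g_adj g_im] cs_n cs_uniq /allP cs_adj /allP cs_l.
have pre (i : 'I_n) : exists x, g x = nth (0, 0) cs i.
  by apply/g_im/andP/cs_l/mem_nth; rewrite cs_n.
have [f fP] := fin_all_exists pre; exists f.
  move=> i j /(congr1 g); rewrite !fP => /eqP; rewrite nth_uniq ?cs_n // => /eqP.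
  exact: val_inj.
move=> i j; have [->|ij] := eqVneq i j; first by rewrite !adj_irrefl.
rewrite g_adj !fP /= /list_adj /= ij.
have mem_i (k : 'I_n) : (k : nat) \in iota 0 n by rewrite mem_iota ltn_ord.
have /allP/(_ _ (mem_i j)) := cs_adj _ (mem_i i).
by rewrite [_ == _ :> nat](negPf ij) => /eqP.
Qed.

(** The bounds [bd] on the legs make [cs] contain all positions of vertices of [B]; the index in
    [cs] is the embedding. *)
Lemma legs_list b (B : sgraph) l n E (bd : seq nat) (cs : seq (nat * nat)) :
  legged b B l -> size cs = n ->
  all (fun i => all (fun t => (i, t) \in cs) (iota 0 (nth 0 bd i))) [:: 0; 1; 2] ->
  all (fun i => all (fun j => (i == j) ||
    (net_adj b (nth (0, 0) cs i) (nth (0, 0) cs j) == edge E i j)) (iota 0 n)) (iota 0 n) ->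
  all (fun i => l i <= nth 0 bd i) [:: 0; 1; 2] -> embeds B (list_graph n E).
Proof.
case=> g [g_inj g_adj g_im] cs_n /allP cs_bd /allP cs_adj /allP l_bd.
have cs_g x : g x \in cs.
  have [/(_ (ex_intro _ x erefl)) [row_lt t_lt] _] := g_im (g x).
  have row_mem : (g x).1 \in [:: 0; 1; 2] by case: (g x).1 row_lt => [|[|[]]].
  have /allP := cs_bd _ row_mem; move/(_ (g x).2); rewrite -surjective_pairing; apply.
  by rewrite mem_iota (leq_trans t_lt) // l_bd.
have lt_n x : index (g x) cs < n by rewrite -cs_n index_mem.
exists (fun x => Ordinal (lt_n x)).
  move=> x y [] /(congr1 (nth (0, 0) cs)); rewrite !nth_index //; exact: g_inj.
move=> x y; have [->|xy] := eqVneq x y; first by rewrite !adj_irrefl.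
have ne : index (g x) cs != index (g y) cs.
  apply: contra_neq xy => /(congr1 (nth (0, 0) cs)); rewrite !nth_index //; exact: g_inj.
rewrite g_adj /= /list_adj /= -val_eqE /= ne.
have mem_i z : index (g z) cs \in iota 0 n by rewrite mem_iota lt_n.
have /allP/(_ _ (mem_i y)) := cs_adj _ (mem_i x).
by rewrite (negPf ne) !nth_index //= => /eqP ->.
Qed.

(** Only nets are symmetric in all three legs, since leg 0 of a spider carries the centre.
    Involutions suffice for sorting. *)
Lemma legged_swap (B : sgraph) l (s : nat -> nat) :
  (forall i, i < 3 -> s i < 3) -> (forall i, i < 3 -> s (s i) = i) ->
  legged true B l -> legged true B (l \o s).
Proof.
move=> s_lt s_inv [g [g_inj g_adj g_im]].
have row_lt x : (g x).1 < 3 by have [/(_ (ex_intro _ x erefl))[]] := g_im (g x).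
exists (fun x => (s (g x).1, (g x).2)); split.
- move=> x y [/(congr1 s)]; rewrite !s_inv // => x1 x2; apply: g_inj.
  by rewrite [g x]surjective_pairing x1 x2 -surjective_pairing.
- move=> x y; rewrite g_adj /net_adj /=.
  suff -> : (s (g x).1 == s (g y).1) = ((g x).1 == (g y).1) by [].
  by apply/eqP/eqP => [/(congr1 s)|->]; rewrite ?s_inv.
move=> [i t]; split=> /=.
  by case=> x [<- <-]; have [/(_ (ex_intro _ x erefl))[? ?] _] := g_im (g x); rewrite s_lt ?s_inv.
case=> i_lt t_lt; have [_ [|x gx]] := g_im (s i, t); first by rewrite s_lt.
by exists x; rewrite gx /= s_inv.
Qed.

Lemma legged_sorted (B : sgraph) l :
  legged true B l -> exists l', [/\ legged true B l', l' 1 <= l' 0 & l' 2 <= l' 1].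
Proof.
have swap (s : nat -> nat) l1 : (forall i, i < 3 -> s i < 3) ->
  (forall i, i < 3 -> s (s i) = i) -> legged true B l1 -> legged true B (l1 \o s).
  exact: legged_swap.
move=> Bl.
have [l1 [Bl1 l1_1 l1_2]] : exists l1, [/\ legged true B l1, l1 1 <= l1 0 & l1 2 <= l1 0].
  have [|l01] := leqP (l 1) (l 0); have [|l02] := leqP (l 2) (l 0).
  - by exists l.
  - move=> l10; exists (l \o (fun i => nth 0 [:: 2; 1; 0] i)); split.
    + by apply: swap => // -[|[|[]]].
    + exact: leq_trans l10 (ltnW l02).
    + exact: ltnW.
  - move=> l20; exists (l \o (fun i => nth 0 [:: 1; 0; 2] i)); split.
    + by apply: swap => // -[|[|[]]].
    + exact: ltnW.
    + exact: leq_trans l20 (ltnW l01).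
  have [l12|/ltnW l12] := leqP (l 2) (l 1).
    exists (l \o (fun i => nth 0 [:: 1; 0; 2] i)); split=> //; last exact: ltnW.
    by apply: swap => // -[|[|[]]].
  exists (l \o (fun i => nth 0 [:: 2; 1; 0] i)); split=> //; last exact: ltnW.
  by apply: swap => // -[|[|[]]].
have [l12|/ltnW l12] := leqP (l1 2) (l1 1); first by exists l1.
exists (l1 \o (fun i => nth 0 [:: 0; 2; 1] i)); split=> //.
by apply: swap => // -[|[|[]]].
Qed.

(** * The forbidden graphs *)

Lemma embeds_list (G : sgraph) n E (x0 : G) (s : seq G) :
  size s = n -> uniq s ->
  all (fun i => all (fun j =>
    adj (nth x0 s i) (nth x0 s j) == (i != j) && edge E i j) (iota 0 n)) (iota 0 n) ->
  embeds (list_graph n E) G.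
Proof.
move=> s_n s_uniq /allP s_adj; exists (fun i : list_graph n E => nth x0 s i).
  by move=> i j /eqP; rewrite nth_uniq ?s_n // => /eqP/val_inj.
have mem_i (k : 'I_n) : (k : nat) \in iota 0 n by rewrite mem_iota ltn_ord.
by move=> i j; have /allP/(_ _ (mem_i j))/eqP := s_adj _ (mem_i i).
Qed.

(** [inord] does not compute, whereas explicit ordinals let the checks of [embeds_list] be
    evaluated. *)
Lemma tri_aE : tri_a = @Ordinal 3 0 isT.
Proof. by apply: val_inj; rewrite /= inordK. Qed.

Lemma tri_bE : tri_b = @Ordinal 3 1 isT.
Proof. by apply: val_inj; rewrite /= inordK. Qed.

Lemma tri_cE : tri_c = @Ordinal 3 2 isT.
Proof. by apply: val_inj; rewrite /= inordK. Qed.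

Definition Z1 := list_graph 4 [:: (0, 1); (0, 2); (1, 2); (0, 3)].
Definition Z4 := list_graph 7
  [:: (0, 1); (0, 2); (1, 2); (0, 3); (3, 4); (4, 5); (5, 6)].
Definition B12 := list_graph 6 [:: (0, 1); (0, 2); (1, 2); (0, 3); (1, 4); (4, 5)].
Definition N111 := list_graph 6 [:: (0, 1); (0, 2); (1, 2); (0, 3); (1, 4); (2, 5)].
Definition spider222 := list_graph 7 [:: (0, 1); (0, 2); (0, 3); (1, 4); (2, 5); (3, 6)].
Definition broken_windmill := list_graph 6
  [:: (0, 1); (0, 2); (0, 3); (0, 4); (0, 5); (2, 3); (4, 5)].
Definition diamond := list_graph 4 [:: (0, 2); (0, 3); (1, 2); (1, 3); (2, 3)].

Lemma Z1_Zgraph : embeds Z1 (Zgraph 1).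
Proof.
rewrite /Zgraph tri_aE; set G := attach_path _ _.
by apply: (@embeds_list G _ _ (inr (@Ordinal 1 0 isT))
  [:: inl (@Ordinal 3 0 isT); inl (@Ordinal 3 1 isT); inl (@Ordinal 3 2 isT);
      inr (@Ordinal 1 0 isT)]).
Qed.

Lemma Z4_Zgraph : embeds Z4 (Zgraph 4).
Proof.
rewrite /Zgraph tri_aE; set G := attach_path _ _.
by apply: (@embeds_list G _ _ (inr (@Ordinal 4 0 isT))
  [:: inl (@Ordinal 3 0 isT); inl (@Ordinal 3 1 isT); inl (@Ordinal 3 2 isT);
      inr (@Ordinal 4 0 isT); inr (@Ordinal 4 1 isT);
      inr (@Ordinal 4 2 isT); inr (@Ordinal 4 3 isT)]).
Qed.

Lemma B12_Bgraph : embeds B12 (Bgraph 1 2).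
Proof.
rewrite /Bgraph tri_aE tri_bE; set G := attach_path (G := attach_path _ _) _ _.
by apply: (@embeds_list G _ _ (inr (@Ordinal 2 0 isT))
  [:: inl (inl (@Ordinal 3 0 isT)); inl (inl (@Ordinal 3 1 isT));
      inl (inl (@Ordinal 3 2 isT)); inl (inr (@Ordinal 1 0 isT));
      inr (@Ordinal 2 0 isT); inr (@Ordinal 2 1 isT)]).
Qed.

Lemma N111_Ngraph : embeds N111 (Ngraph 1 1 1).
Proof.
rewrite /Ngraph tri_aE tri_bE tri_cE.
set G := attach_path (G := attach_path (G := attach_path _ _) _ _) _ _.
by apply: (@embeds_list G _ _ (inr (@Ordinal 1 0 isT))
  [:: inl (inl (inl (@Ordinal 3 0 isT))); inl (inl (inl (@Ordinal 3 1 isT)));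
      inl (inl (inl (@Ordinal 3 2 isT))); inl (inl (inr (@Ordinal 1 0 isT)));
      inl (inr (@Ordinal 1 0 isT)); inr (@Ordinal 1 0 isT)]).
Qed.

Lemma star3_claw : embeds star3 claw.
Proof.
by apply: (@embeds_list claw _ _ (inl (@Ordinal 1 0 isT))
  [:: inl (@Ordinal 1 0 isT); inr (inl (@Ordinal 1 0 isT));
      inr (inr (inl (@Ordinal 1 0 isT))); inr (inr (inr (@Ordinal 1 0 isT)))]).
Qed.

Lemma windmill_Wgraph : embeds windmill Wgraph.
Proof.
by apply: (@embeds_list Wgraph _ _ (inl (@Ordinal 1 0 isT))
  [:: inl (@Ordinal 1 0 isT);
      inr (inl (@Ordinal 2 0 isT)); inr (inl (@Ordinal 2 1 isT));
      inr (inr (inl (@Ordinal 2 0 isT))); inr (inr (inl (@Ordinal 2 1 isT)));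
      inr (inr (inr (@Ordinal 2 0 isT))); inr (inr (inr (@Ordinal 2 1 isT)))]).
Qed.

Lemma broken_windmill_Wstar : embeds broken_windmill Wstar.
Proof.
by apply: (@embeds_list Wstar _ _ (inl (@Ordinal 1 0 isT))
  [:: inl (@Ordinal 1 0 isT); inr (inl (@Ordinal 1 0 isT));
      inr (inr (inl (@Ordinal 2 0 isT))); inr (inr (inl (@Ordinal 2 1 isT)));
      inr (inr (inr (@Ordinal 2 0 isT))); inr (inr (inr (@Ordinal 2 1 isT)))]).
Qed.

Lemma eq_set2 (T : finType) (i j a b : T) : i != j ->
  ([set i; j] == [set a; b]) = ((i == a) && (j == b)) || ((i == b) && (j == a)).
Proof.
move=> ij; apply/eqP/orP => [E|[/andP[/eqP-> /eqP->]|/andP[/eqP-> /eqP->]]] //.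
  have := set21 i j; have := set22 i j; rewrite E !inE.
  case/orP=> /eqP j_eq /orP[] /eqP i_eq; subst; rewrite ?eqxx in ij *; by auto.
by rewrite setUC.
Qed.

Lemma diamond_K4minus : embeds diamond K4minus.
Proof.
exists id => // i j; rewrite /= /delete_edge_adj /list_adj /complete_adj /=.
have [->|ij] := eqVneq i j; first by rewrite complete_irrefl.
rewrite eq_set2 //.
have E k (x : 'I_4) : k < 4 -> (x == inord k) = (x == k :> nat).
  by move=> k_lt; rewrite -(inj_eq val_inj) /= inordK.
rewrite !E // /complete_adj /=.
by move: i j ij => [[|[|[|[|?]]]] ?] [[|[|[|[|?]]]] ?].
Qed.

Lemma path_graph_list n : embeds (list_graph n [seq (i, i.+1) | i <- iota 0 n.-1]) (path_graph n).
Proof.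
exists id => // i j; rewrite /= /path_adj /list_adj /= /edge.
have mem_path a b : b < n -> ((a, b) \in [seq (i, i.+1) | i <- iota 0 n.-1]) = (a.+1 == b).
  move=> b_lt; apply/mapP/eqP => [[c _ [ac bc]]|ab]; first by rewrite ac bc.
  exists a; last by rewrite ab.
  by rewrite mem_iota; move: b_lt; rewrite -ab; case: (n).
rewrite !mem_path //; have [->|//] := eqVneq i j.
by rewrite orbb gtn_eqF.
Qed.

Lemma path_graph_sub m n : m <= n -> embeds (path_graph m) (path_graph n).
Proof. by move=> mn; exists (widen_ord mn) => // i j [] /val_inj. Qed.

Lemma P4_path : embeds P4 (path_graph 4).
Proof. exact: (path_graph_list 4). Qed.

Lemma P5_path : embeds P5 (path_graph 5).
Proof. exact: (path_graph_list 5). Qed.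

Lemma P6_path : embeds P6 (path_graph 6).
Proof. exact: (path_graph_list 6). Qed.

Lemma path6_Z4 : embeds (path_graph 6) Z4.
Proof.
(* The triangle vertex 2 is left out. *)
pose s i := nth 0 [:: 1; 0; 3; 4; 5; 6] i.
have s_lt (i : 'I_6) : s i < 7 by case: i => [[|[|[|[|[|[|?]]]]]] ?].
exists (fun i : path_graph 6 => Ordinal (s_lt i)).
  move=> [i i_lt] [j j_lt] /(congr1 val) /= ij; apply: val_inj => /=.
  by move: i j i_lt j_lt ij => [|[|[|[|[|[|?]]]]]] [|[|[|[|[|[|?]]]]]].
by move=> [[|[|[|[|[|[|?]]]]]] ?] [[|[|[|[|[|[|?]]]]]] ?].
Qed.

Lemma independent4_path7 : embeds independent4 (path_graph 7).
Proof.
by apply: (@embeds_list (path_graph 7) _ _ (@Ordinal 7 0 isT)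
  [:: @Ordinal 7 0 isT; @Ordinal 7 2 isT; @Ordinal 7 4 isT; @Ordinal 7 6 isT]).
Qed.

(** The middle vertices of [claw_star] are sets, awkward to compute with; this criterion needs only
    the relations among the centre [c], the middle vertices [m] and the ends [n]. *)
Lemma embeds_spider222 (G : sgraph) (c : G) (m n : 'I_3 -> G) :
  injective m -> injective n -> (forall i, c != m i) -> (forall i, c != n i) ->
  (forall i j, m i != n j) -> (forall i, adj c (m i)) -> (forall i, ~~ adj c (n i)) ->
  (forall i j, ~~ adj (m i) (m j)) -> (forall i j, ~~ adj (n i) (n j)) ->
  (forall i j, adj (m i) (n j) = (i == j)) -> embeds spider222 G.
Proof.
move=> m_inj n_inj cm cn mn acm acn amm ann amn.
pose i0 : 'I_3 := Ordinal (isT : 0 < 3); pose i1 : 'I_3 := Ordinal (isT : 1 < 3).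
pose i2 : 'I_3 := Ordinal (isT : 2 < 3).
have anm i j : adj (n i) (m j) = (i == j) by rewrite adj_sym amn eq_sym.
have amc i : adj (m i) c by rewrite adj_sym.
have anc i : adj (n i) c = false by rewrite adj_sym (negPf (acn i)).
apply: (@embeds_list G _ _ c [:: c; m i0; m i1; m i2; n i0; n i1; n i2]) => //.
  by rewrite /= !inE !(inj_eq m_inj) !(inj_eq n_inj) !negb_or !cm !cn !mn.
rewrite /= !adj_irrefl !acm !amc !anc !amn !anm.
by rewrite !(negPf (acn _)) !(negPf (amm _ _)) !(negPf (ann _ _)).
Qed.

Lemma spider222_claw_star : embeds spider222 claw_star.
Proof.
pose x0 : claw := inl (@Ordinal 1 0 isT).
pose leaf (i : 'I_3) : claw := nth x0 [:: inr (inl (@Ordinal 1 0 isT));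
  inr (inr (inl (@Ordinal 1 0 isT))); inr (inr (inr (@Ordinal 1 0 isT)))] i.
have leaf_adj i : adj x0 (leaf i) by case: i => [[|[|[|?]]] ?].
have leaf_inj : injective leaf.
  by move=> [[|[|[|?]]] ?] [[|[|[|?]]] ?] //= _; apply: val_inj.
have leaf_x0 i : (leaf i == x0) = false by case: i => [[|[|[|?]]] ?].
have e i : is_edge [set x0; leaf i].
  by apply/existsP; exists x0; apply/existsP; exists (leaf i); rewrite leaf_adj eqxx.
pose mid i : claw_star := inr (exist _ [set x0; leaf i] (e i)).
have leaf_mid i j : (leaf j \in [set x0; leaf i]) = (i == j).
  by rewrite in_set2 leaf_x0 (inj_eq leaf_inj) eq_sym.
have x0_mid i : x0 \in [set x0; leaf i] by apply: set21.
apply: (@embeds_spider222 claw_star (inl x0) mid (fun i => inl (leaf i))) => //.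
- move=> i j [] /setP/(_ (leaf i)); rewrite !leaf_mid eqxx => /esym/eqP; exact: esym.
- by move=> i j [] /leaf_inj.
- move=> i; apply: contraFneq (leaf_x0 i) => -[E]; by rewrite -E.
Qed.

(** [q] is the position along the path. Both embeddings are obtained, since [A] has to be placed
    inside paths and shorter paths inside [A]. *)
Lemma legs_path b (A : sgraph) l (q : nat * nat -> nat) k :
  legged b A l ->
  (forall p p', p.1 < 3 -> p.2 < l p.1 -> p'.1 < 3 -> p'.2 < l p'.1 ->
     net_adj b p p' = ((q p).+1 == q p') || ((q p').+1 == q p)) ->
  (forall p p', p.1 < 3 -> p.2 < l p.1 -> p'.1 < 3 -> p'.2 < l p'.1 ->
     q p = q p' -> p = p') ->
  (forall p, p.1 < 3 -> p.2 < l p.1 -> q p < k) ->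
  (forall s, s < k -> exists p, [/\ p.1 < 3, p.2 < l p.1 & q p = s]) ->
  embeds A (path_graph k) /\ embeds (path_graph k) A.
Proof.
case=> g [g_inj g_adj g_im] q_adj q_inj q_lt q_surj.
have g_region x : (g x).1 < 3 /\ (g x).2 < l (g x).1.
  by have [/(_ (ex_intro _ x erefl))] := g_im (g x).
have qg_lt x : q (g x) < k by have [? ?] := g_region x; apply: q_lt.
have qg_adj x y : adj x y = ((q (g x)).+1 == q (g y)) || ((q (g y)).+1 == q (g x)).
  by have [? ?] := g_region x; have [? ?] := g_region y; rewrite g_adj q_adj.
split.
  exists (fun x => Ordinal (qg_lt x)) => [x y [] qxy|x y]; last by rewrite qg_adj.
  by have [? ?] := g_region x; have [? ?] := g_region y; apply/g_inj/q_inj.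
have pre (s : 'I_k) : exists x, q (g x) = s.
  have [p [p1 p2 ps]] := q_surj s (ltn_ord s).
  by have [_ [//|x gx]] := g_im p; exists x; rewrite gx.
have [f fP] := fin_all_exists pre; exists f.
  by move=> s t /(congr1 (q \o g)); rewrite /= !fP => /val_inj.
by move=> s t; rewrite qg_adj !fP.
Qed.

Lemma legs_centre (A : sgraph) l :
  connected A -> legged false A l -> l 0 = 0 -> 0 < l 1 -> 0 < l 2 -> False.
Proof.
move=> A_conn [g [g_inj g_adj g_im]] l0 l1 l2.
have [x gx] : exists x, g x = (1, 0) by apply/g_im.
have [y gy] : exists y, g y = (2, 0) by apply/g_im.
pose X := [pred z | (g z).1 == 1].
have X_closed z z' : adj z z' -> z \in X -> z' \in X.
  rewrite g_adj /net_adj !inE => zz' /eqP z1; move: zz'; rewrite z1.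
  case: eqP => [<-//|_ /and3P[_ _ /= /eqP z'0]].
  have [/(_ (ex_intro _ z' erefl))[_]] := g_im (g z').
  by rewrite z'0 l0.
have := connected_closed A_conn X_closed (x := x) y.
by rewrite !inE gx gy => /(_ isT).
Qed.

(** When one leg has no vertex besides the centre, the other two form a path through it. The bound
    on leg 0 is larger by one because it counts the centre. *)
Lemma spider_or_path (A : sgraph) l : connected A -> legged false A l ->
  [/\ 1 < l 0, 0 < l 1 & 0 < l 2] \/
  exists k, embeds A (path_graph k) /\ embeds (path_graph k) A.
Proof.
move=> A_conn Al.
have [c0|c_gt0] := posnP (l 2).
  right; exists (l 1 + l 0).
  (* Positions run from the tip of leg 1 inwards, then outwards along leg 0. *)
  apply: (legs_path (q := fun p => if p.1 == 1 then l 1 - p.2.+1 else l 1 + p.2)) Al _ _ _ _.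
  - move=> [[|[|[|i]]] t] [[|[|[|j]]] s] //=; rewrite /net_adj /= ?c0 ?ltn0 //; lia.
  - move=> [[|[|[|i]]] t] [[|[|[|j]]] s] //=; rewrite ?c0 ?ltn0 // => *; try (exfalso; lia).
      by congr (_, _); lia.
    by congr (_, _); lia.
  - move=> [[|[|[|i]]] t] //=; rewrite ?c0 ?ltn0 //; lia.
  move=> s s_lt; have [s_l1|s_l1] := ltnP s (l 1).
    by exists (1, l 1 - s.+1) => /=; split=> //; lia.
  by exists (0, s - l 1) => /=; split=> //; lia.
have [b0|b_gt0] := posnP (l 1).
  right; exists (l 2 + l 0).
  apply: (legs_path (q := fun p => if p.1 == 2 then l 2 - p.2.+1 else l 2 + p.2)) Al _ _ _ _.
  - move=> [[|[|[|i]]] t] [[|[|[|j]]] s] //=; rewrite /net_adj /= ?b0 ?ltn0 //; lia.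
  - move=> [[|[|[|i]]] t] [[|[|[|j]]] s] //=; rewrite ?b0 ?ltn0 // => *; try (exfalso; lia).
      by congr (_, _); lia.
    by congr (_, _); lia.
  - move=> [[|[|[|i]]] t] //=; rewrite ?b0 ?ltn0 //; lia.
  move=> s s_lt; have [s_l1|s_l1] := ltnP s (l 2).
    by exists (2, l 2 - s.+1) => /=; split=> //; lia.
  by exists (0, s - l 2) => /=; split=> //; lia.
have [a_gt1|] := ltnP 1 (l 0); first by left.
rewrite leq_eqVlt ltnS leqn0 => /orP[/eqP a1|/eqP a0]; last first.
  by case: (legs_centre A_conn Al a0).
right; exists (l 1 + (l 2).+1).
(* Leg 0 is the centre alone, placed between legs 1 and 2. *)
apply: (legs_path (q := fun p => if p.1 == 1 then l 1 - p.2.+1 else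
  if p.1 == 0 then l 1 else l 1 + p.2.+1)) Al _ _ _ _.
- move=> [[|[|[|i]]] t] [[|[|[|j]]] s] //=; rewrite /net_adj /= ?a1 //; lia.
- move=> [[|[|[|i]]] t] [[|[|[|j]]] s] //=; rewrite ?a1 // => *; try (exfalso; lia);
  by congr (_, _); lia.
- move=> [[|[|[|i]]] t] //=; rewrite ?a1 //; lia.
move=> s s_lt; case: (ltngtP s (l 1)) => s_l1.
- by exists (1, l 1 - s.+1) => /=; split=> //; lia.
- by exists (2, s - (l 1).+1) => /=; split=> //; lia.
by exists (0, 0) => /=; rewrite a1.
Qed.

(** * Classification by leg lengths *)

Ltac in_legs := rewrite /= ?andbT; lia.

(** Unless all legs have length 1, a leg of length 2 continues through the centre to a P_4; a leg of
    length 3 with one vertex of each other leg is [spider113]. *)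
Lemma spider_class (A : sgraph) l : legged false A l ->
  1 < l 0 -> 0 < l 1 -> 0 < l 2 ->
  embeds star3 A /\ (embeds A star3 \/
    embeds P4 A /\ (embeds A spider222 \/ embeds spider113 A)).
Proof.
move=> Al l0 l1 l2; split.
  by apply: (legs_pattern (cs := [:: (0, 0); (0, 1); (1, 0); (2, 0)])) Al _ _ _ _ => //; in_legs.
have [small|large] := boolP [&& l 0 <= 2, l 1 <= 1 & l 2 <= 1].
  left; apply: (legs_list (bd := [:: 2; 1; 1])
    (cs := [:: (0, 0); (0, 1); (1, 0); (2, 0)])) Al _ _ _ _ => //; in_legs.
right; split.
  have [l0'|l0'] := ltnP 2 (l 0).
    by apply: (legs_pattern (cs := [:: (1, 0); (0, 0); (0, 1); (0, 2)])) Al _ _ _ _ => //; in_legs.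
  have [l1'|l1'] := ltnP 1 (l 1).
    by apply: (legs_pattern (cs := [:: (2, 0); (0, 0); (1, 0); (1, 1)])) Al _ _ _ _ => //; in_legs.
  by apply: (legs_pattern (cs := [:: (1, 0); (0, 0); (2, 0); (2, 1)])) Al _ _ _ _ => //; in_legs.
have [l0'|l0'] := ltnP 3 (l 0).
  right; apply: (legs_pattern
    (cs := [:: (0, 0); (1, 0); (2, 0); (0, 1); (0, 2); (0, 3)])) Al _ _ _ _ => //; in_legs.
have [l1'|l1'] := ltnP 2 (l 1).
  right; apply: (legs_pattern
    (cs := [:: (0, 0); (0, 1); (2, 0); (1, 0); (1, 1); (1, 2)])) Al _ _ _ _ => //; in_legs.
have [l2'|l2'] := ltnP 2 (l 2).
  right; apply: (legs_pattern
    (cs := [:: (0, 0); (0, 1); (1, 0); (2, 0); (2, 1); (2, 2)])) Al _ _ _ _ => //; in_legs.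
left; apply: (legs_list (bd := [:: 3; 2; 2])
  (cs := [:: (0, 0); (0, 1); (1, 0); (2, 0); (0, 2); (1, 1); (2, 1)])) Al _ _ _ _ => //; in_legs.
Qed.

(** Excluding four independent vertices bounds the sorted legs. The one maximal net that survives
    besides the three targets is B_{2,2}, which is why [bull22] appears. *)
Lemma net_class (B : sgraph) l : legged true B l -> l 1 <= l 0 -> l 2 <= l 1 ->
  [\/ embeds B Z4, embeds B B12 | embeds B N111] \/
  embeds independent4 B \/ embeds bull22 B.
Proof.
move=> Bl l10 l21.
have indep cs : size cs = 4 -> uniq cs ->
    all (fun i => all (fun j => (i == j) ||
      (net_adj true (nth (0, 0) cs i) (nth (0, 0) cs j) == edge [::] i j)) (iota 0 4)) (iota 0 4) ->
    all (fun p => (p.1 < 3) && (p.2 < l p.1)) cs -> embeds independent4 B.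
  by move=> *; apply: (legs_pattern (cs := cs)) Bl _ _ _ _.
pose path_edges := [seq (i, i.+1) | i <- iota 0 5].
have path6 cs bd : size cs = 6 ->
    all (fun i => all (fun t => (i, t) \in cs) (iota 0 (nth 0 bd i))) [:: 0; 1; 2] ->
    all (fun i => all (fun j => (i == j) ||
      (net_adj true (nth (0, 0) cs i) (nth (0, 0) cs j) == edge path_edges i j))
      (iota 0 6)) (iota 0 6) ->
    all (fun i => l i <= nth 0 bd i) [:: 0; 1; 2] -> embeds B Z4.
  move=> *; apply: embeds_trans path6_Z4; apply: embeds_trans (path_graph_list 6).
  exact: (legs_list (bd := bd) (cs := cs)) Bl _ _ _ _.
(* Without leg 2 the graph is a path of order [l 0 + l 1]: order 7 yields four independent vertices,
   and order at most 6 fits into [Z4]. *)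
have [l2|l2_gt0] := posnP (l 2).
  have [l0|l0] := leqP 7 (l 0).
    by right; left; apply: (indep [:: (0, 0); (0, 2); (0, 4); (0, 6)]) => //; in_legs.
  have [l01|l01] := leqP 7 (l 0 + l 1).
    right; left; case: (ltngtP (l 0) 5) => l0'.
    - by apply: (indep [:: (1, 0); (1, 2); (0, 1); (0, 3)]) => //; in_legs.
    - by apply: (indep [:: (0, 1); (0, 3); (0, 5); (1, 0)]) => //; in_legs.
    - by apply: (indep [:: (1, 1); (0, 0); (0, 2); (0, 4)]) => //; in_legs.
  left; constructor 1; case E: (l 1) => [|[|[|l1]]].
  - by apply: (path6 [:: (0, 0); (0, 1); (0, 2); (0, 3); (0, 4); (0, 5)]
      [:: 6; 0; 0]) => //; in_legs.
  - by apply: (path6 [:: (1, 0); (0, 0); (0, 1); (0, 2); (0, 3); (0, 4)]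
      [:: 5; 1; 0]) => //; in_legs.
  - by apply: (path6 [:: (1, 1); (1, 0); (0, 0); (0, 1); (0, 2); (0, 3)]
      [:: 4; 2; 0]) => //; in_legs.
  - by apply: (path6 [:: (1, 2); (1, 1); (1, 0); (0, 0); (0, 1); (0, 2)]
      [:: 3; 3; 0]) => //; in_legs.
have [l2_gt1|l2_le1] := ltnP 1 (l 2).
  have [l0|l0] := ltnP 2 (l 0).
    by right; left; apply: (indep [:: (1, 1); (2, 1); (0, 0); (0, 2)]) => //; in_legs.
  left; constructor 3; apply: (legs_list (bd := [:: 2; 2; 2])
    (cs := [:: (0, 0); (1, 0); (2, 0); (0, 1); (1, 1); (2, 1)])) Bl _ _ _ _ => //; in_legs.
have [l1_gt1|l1_le1] := ltnP 1 (l 1); last first.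
  have [l0|l0] := ltnP 5 (l 0).
    by right; left; apply: (indep [:: (1, 0); (0, 1); (0, 3); (0, 5)]) => //; in_legs.
  left; constructor 1; apply: (legs_list (bd := [:: 5; 1; 1])
    (cs := [:: (0, 0); (1, 0); (2, 0); (0, 1); (0, 2); (0, 3); (0, 4)])) Bl _ _ _ _ => //; in_legs.
have [l1_gt2|l1_le2] := ltnP 2 (l 1).
  right; right; apply: (legs_pattern
    (cs := [:: (0, 0); (1, 0); (2, 0); (0, 1); (0, 2); (1, 1); (1, 2)])) Bl _ _ _ _ => //; in_legs.
have [l0|l0] := ltnP 3 (l 0).
  by right; left; apply: (indep [:: (2, 0); (1, 1); (0, 1); (0, 3)]) => //; in_legs.
left; constructor 2; apply: (legs_list (bd := [:: 3; 2; 1])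
  (cs := [:: (1, 0); (0, 0); (2, 0); (1, 1); (0, 1); (0, 2)])) Bl _ _ _ _ => //; in_legs.
Qed.

Lemma net_P4_class (B : sgraph) l : legged true B l -> l 1 <= l 0 -> l 2 <= l 1 ->
  [\/ embeds P4 B, embeds B P3 | embeds B Z1 /\ embeds K3 B].
Proof.
move=> Bl l10 l21.
have [l1_gt1|l1_le1] := ltnP 1 (l 1).
  constructor 1.
  by apply: (legs_pattern (cs := [:: (0, 1); (0, 0); (1, 0); (1, 1)])) Bl _ _ _ _ => //; in_legs.
have [l1|l1_gt0] := posnP (l 1).
  have [l0|l0] := ltnP 3 (l 0).
    constructor 1.
    by apply: (legs_pattern (cs := [:: (0, 0); (0, 1); (0, 2); (0, 3)])) Bl _ _ _ _ => //; in_legs.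
  constructor 2; apply: (legs_list (bd := [:: 3; 0; 0])
    (cs := [:: (0, 1); (0, 0); (0, 2)])) Bl _ _ _ _ => //; in_legs.
have [l0|l0] := ltnP 2 (l 0).
  constructor 1.
  by apply: (legs_pattern (cs := [:: (1, 0); (0, 0); (0, 1); (0, 2)])) Bl _ _ _ _ => //; in_legs.
have [l2|l2_gt0] := posnP (l 2).
  constructor 2; apply: (legs_list (bd := [:: 2; 1; 0])
    (cs := [:: (0, 0); (1, 0); (0, 1)])) Bl _ _ _ _ => //; in_legs.
constructor 3; split.
  apply: (legs_list (bd := [:: 2; 1; 1])
    (cs := [:: (0, 0); (1, 0); (2, 0); (0, 1)])) Bl _ _ _ _ => //; in_legs.
by apply: (legs_pattern (cs := [:: (0, 0); (1, 0); (2, 0)])) Bl _ _ _ _ => //; in_legs.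
Qed.

Lemma embeds_to_list (B : sgraph) n E (h : B -> nat) :
  (forall x, h x < n) -> (forall x y, h x = h y -> x = y) ->
  (forall x y, x != y -> adj x y = edge E (h x) (h y)) ->
  embeds B (list_graph n E).
Proof.
move=> h_lt h_inj h_adj; exists (fun x => Ordinal (h_lt x)).
  by move=> x y [] /h_inj.
move=> x y; have [->|xy] := eqVneq x y; first by rewrite !adj_irrefl.
rewrite h_adj //= /list_adj /= -val_eqE /=.
by rewrite (contra_neq (h_inj x y) xy).
Qed.

Lemma embeds_inv (H G : sgraph) : embeds H G -> #|G| <= #|H| -> embeds G H.
Proof.
case=> f f_inj f_adj GH; have [g fg gf] := inj_card_bij f_inj GH.
by exists g => [|x y]; [apply: can_inj gf | rewrite -f_adj !gf].
Qed.

Lemma K3_of_clique (B : sgraph) (S : {set B}) :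
  {in S &, forall x y, x != y -> adj x y} -> 2 < #|S| -> embeds K3 B.
Proof.
move=> S_adj; case/card_gt2P=> x [y [z [[xS yS zS] [xy yz zx]]]].
have [yx zy xz] : [/\ y != x, z != y & x != z] by split; rewrite eq_sym.
apply: (@embeds_list B _ _ x [:: x; y; z]) => //.
  by rewrite /= !inE negb_or xy xz yz.
by rewrite /= !adj_irrefl !S_adj.
Qed.

Lemma K4_of_clique (B : sgraph) (S : {set B}) :
  {in S &, forall x y, x != y -> adj x y} -> 3 < #|S| -> embeds K4 B.
Proof.
move=> S_adj S_gt3; have /card_gt0P[w wS] : 0 < #|S| by apply: leq_trans S_gt3.
have : 2 < #|S :\ w| by rewrite (cardsD1 w S) wS in S_gt3.
case/card_gt2P=> x [y [z [[/setD1P[xw xS] /setD1P[yw yS] /setD1P[zw zS]] [xy yz zx]]]].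
have [yx zy xz] : [/\ y != x, z != y & x != z] by split; rewrite eq_sym.
have [wx wy wz] : [/\ w != x, w != y & w != z] by split; rewrite eq_sym.
apply: (@embeds_list B _ _ w [:: w; x; y; z]) => //.
  by rewrite /= !inE !negb_or wx wy wz xy xz yz.
by rewrite /= !adj_irrefl !S_adj.
Qed.

(** * Induced subgraphs of 2K_1 + 3K_m *)

Section CliquesOver2K1.
Variables (B : sgraph) (m : nat) (f : B -> blow_up cliques_over_2K1 m).
Hypotheses (f_inj : injective f) (f_adj : forall x y, adj (f x) (f y) = adj x y).
Hypotheses (B_conn : connected B) (B_order : 3 <= #|B|).
Hypotheses (B_K4 : ~ embeds K4 B) (B_C4 : ~ embeds C4 B).

Let t (x : B) : nat := typ (f x).
Let fibre (i : nat) : {set B} := [set x | t x == i].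
Let pos (x : B) : nat := index x (enum (fibre (t x))).

Let t_lt x : t x < 5.
Proof. exact: typ_lt. Qed.

Let t_single x y : t x = t y -> t x < 2 -> x = y.
Proof.
move=> txy tx; apply: f_inj; apply: typ_single => //.
by move: tx; rewrite /t; case: (typ _) => [|[]].
Qed.

Let t_adj x y : x != y ->
  adj x y = if t x < 2 then 1 < t y else (t y < 2) || (t x == t y).
Proof.
move=> xy; rewrite -f_adj blow_adjE (inj_eq f_inj) xy.
move: (t_lt x) (t_lt y); rewrite /t.
by case: (typ (f x)) => [|[|[|[|[|?]]]]]; case: (typ (f y)) => [|[|[|[|[|?]]]]].
Qed.

Let pos_lt x : pos x < #|fibre (t x)|.
Proof. by rewrite /pos cardE index_mem mem_enum inE. Qed.

Let pos_inj x y : t x = t y -> pos x = pos y -> x = y.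
Proof.
move=> txy; rewrite /pos -txy => /(congr1 (nth x (enum (fibre (t x))))).
by rewrite !nth_index // mem_enum inE // txy.
Qed.

Let cut_fibre_clique u i : t u < 2 -> 1 < i ->
  {in u |: fibre i &, forall x y, x != y -> adj x y}.
Proof.
move=> tu i_gt1 x y /setU1P xS /setU1P yS xy; rewrite t_adj //.
case: xS xy => [->|]; case: yS => [->|]; rewrite ?eqxx // !inE.
- by move/eqP=> ->; rewrite tu.
- by move=> /eqP -> xu; rewrite tu orTb ltnNge i_gt1.
- by move=> /eqP -> /eqP ->; rewrite eqxx orbT ltnNge i_gt1.
Qed.

Let card_cut_fibre u i : t u < 2 -> 1 < i -> #|u |: fibre i| = #|fibre i|.+1.
Proof. by move=> tu i_gt1; rewrite cardsU1 inE ltn_eqF // (leq_trans tu). Qed.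

Let fibre_le2 u i : t u < 2 -> 1 < i -> #|fibre i| <= 2.
Proof.
move=> tu i_gt1; rewrite leqNgt; apply/negP => gt2; apply: B_K4.
by apply: (K4_of_clique (cut_fibre_clique tu i_gt1)); rewrite card_cut_fibre.
Qed.

Let fibre_K3 u i : t u < 2 -> 1 < i -> 1 < #|fibre i| -> embeds K3 B.
Proof.
move=> tu i_gt1 gt1.
by apply: (K3_of_clique (cut_fibre_clique tu i_gt1)); rewrite card_cut_fibre.
Qed.

Let small_or_K3 :
  embeds K3 B \/ forall u i, t u < 2 -> 1 < i -> #|fibre i| <= 1.
Proof.
have [K3B|K3B] := classic (embeds K3 B); [by left | right] => u i tu i_gt1.
by rewrite leqNgt; apply/negP => gt1; apply: K3B; apply: fibre_K3 tu i_gt1 gt1.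
Qed.

(** The reverse embeddings matter as well: [windmill] and [star3] inside [B] are the patterns by
    which later families exclude it. *)
Let class_type : Prop :=
  [\/ embeds B diamond, embeds B broken_windmill
    | embeds B windmill /\ embeds windmill B] /\
  [\/ embeds K3 B, embeds B P3 | embeds star3 B /\ embeds B star3].

(** Without cut vertices a connected [B] lies in one of the cliques, so it is a triangle. *)
Let class_no_cut : (forall x, 1 < t x) -> class_type.
Proof.
move=> t_gt1; have [r _] : exists r : B, true by case: B_conn => /card_gt0P[r]; exists r.
have t_lt2 x : (t x < 2) = false by rewrite ltnNge t_gt1.
have t_r x : t x = t r.
  apply/eqP; apply: (connected_closed B_conn (X := [pred y | t y == t r]) _ (x := r));
    last by rewrite inE.
  move=> y z yz; have ne : y != z by apply: contraTneq yz => ->; rewrite adj_irrefl.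
  rewrite !inE => /eqP <-; move: yz; rewrite t_adj //.
  by rewrite !t_lt2 eq_sym.
have all_adj (x y : B) : x != y -> adj x y.
  by move=> xy; rewrite t_adj // !t_lt2 (t_r x) (t_r y) eqxx.
have card_fibre x : #|fibre (t x)| = #|B|.
  by apply: eq_card => y; rewrite !inE !t_r eqxx.
have le3 : #|B| <= 3.
  rewrite leqNgt; apply/negP => gt3; apply: B_K4.
  by apply: (@K4_of_clique _ setT); rewrite ?cardsT // => x y _ _; apply: all_adj.
split; last first.
  constructor 1.
  by apply: (@K3_of_clique _ setT); rewrite ?cardsT // => x y _ _; apply: all_adj.
constructor 2; apply: (embeds_to_list (h := fun x => nth 0 [:: 0; 2; 3] (pos x))).
- by move=> x; case: (pos x) (pos_lt x) => [|[|[|?]]] //=; rewrite nth_nil.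
- move=> x y; have := pos_inj (x := x) (y := y); rewrite !t_r => /(_ erefl).
  have := pos_lt x; have := pos_lt y; rewrite !card_fibre => /leq_trans/(_ le3) + /leq_trans/(_ le3).
  by case: (pos x) => [|[|[|?]]]; case: (pos y) => [|[|[|?]]] //= _ _ ->.
move=> x y xy; rewrite all_adj //.
have : pos x != pos y by apply: contra_neq xy; apply: pos_inj; rewrite !t_r.
have := pos_lt x; have := pos_lt y; rewrite !card_fibre => /leq_trans/(_ le3) + /leq_trans/(_ le3).
by case: (pos x) => [|[|[|?]]]; case: (pos y) => [|[|[|?]]].
Qed.

(** Two cut vertices and vertices of two different cliques would induce a C_4, so all other vertices
    lie in one clique, and at most two of them since there is no K_4. *)
Let class_two_cuts u v : t u < 2 -> t v < 2 -> u != v -> class_type.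
Proof.
move=> tu tv uv.
have cut x : t x < 2 -> x = u \/ x = v.
  move=> tx; have [xu|xu] := eqVneq (t x) (t u); first by left; apply: t_single.
  right; apply: t_single => //; have : t u != t v by apply: contra_neq uv => /t_single; apply.
  by move: tx tu tv xu; case: (t x) => [|[|?]]; case: (t u) => [|[|?]]; case: (t v) => [|[|?]].
have same x y : 1 < t x -> 1 < t y -> t x = t y.
  move=> tx ty; apply/eqP; apply: contraT => txy; case: B_C4.
  have ne a b : t a != t b -> (a == b) = false by apply: contraNF => /eqP->.
  have lt a b : t a < 2 -> 1 < t b -> (a != b) * (b != a) * (adj a b) * (adj b a).
    move=> ta tb; have ab : a != b by apply: contraTneq tb => <-; rewrite -leqNgt.
    by rewrite [b == a]eq_sym ab [adj b a]adj_sym t_adj // ta tb.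
  apply: (@embeds_list B _ _ u [:: u; x; v; y]) => //.
    by rewrite /= !inE !negb_or uv !(lt u x) // !(lt u y) // !(lt v x) // !(lt v y) // (ne _ _ txy).
  have uv0 : adj u v = false by rewrite t_adj // tu leqNgt tv.
  have xy0 : adj x y = false.
    by rewrite t_adj ?ne // ltnNge tx /= (negPf txy) orbF ltnNge ty.
  have [vu0 yx0] : adj v u = false /\ adj y x = false by rewrite ![adj _ u]adj_sym [adj y _]adj_sym.
  by rewrite /= !adj_irrefl !(lt u x) // !(lt u y) // !(lt v x) // !(lt v y) // uv0 xy0 vu0 yx0.
have le2 x : 1 < t x -> #|fibre (t x)| <= 2 := fibre_le2 tu.
(* In [diamond] the vertices 0 and 1 are the non-adjacent pair, here the two cut vertices. *)
pose h x := if x == u then 0 else if x == v then 1 else 2 + pos x.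
have vu : (v == u) = false by rewrite eq_sym (negPf uv).
have big x : x != u -> x != v -> 1 < t x.
  by move=> xu xv; rewrite ltnNge -ltnS; apply/negP => /cut[] E; rewrite E eqxx in xu xv.
have h_cases x : [\/ x = u /\ h x = 0, x = v /\ h x = 1 |
    [/\ 1 < t x, h x = 2 + pos x & pos x < #|fibre (t x)|]].
  rewrite /h; have [->|xu] := eqVneq x u; first by constructor 1.
  have [->|xv] := eqVneq x v; first by constructor 2.
  by constructor 3; split; rewrite ?big.
have h_inj x y : h x = h y -> x = y.
  case: (h_cases x) => [[-> ->]|[-> ->]|[tx -> _]];
  case: (h_cases y) => [[-> ->]|[-> ->]|[ty -> _]] // [].
  by move/pos_inj; apply; apply: same.
have [tuv uv0] : (t v < 2) * (t u < 2) /\ adj u v = false.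
  by rewrite tu tv t_adj // tu leqNgt tv.
have hadj E : ~~ edge E 0 1 -> (forall p, p < 2 -> edge E 0 (2 + p) && edge E 1 (2 + p)) ->
    (forall x y, x != y -> 1 < t x -> 1 < t y -> edge E (2 + pos x) (2 + pos y)) ->
    forall x y, x != y -> adj x y = edge E (h x) (h y).
  move=> E01 E2 E22.
  have E2' p x : 1 < t x -> p < 2 -> edge E p (2 + pos x).
    move=> tx p_lt; have /andP[] := E2 _ (leq_trans (pos_lt x) (le2 x tx)).
    by case: p p_lt => [|[]].
  move=> x y xy; case: (h_cases x) => [[xE ->]|[xE ->]|[tx -> _]];
  case: (h_cases y) => [[yE ->]|[yE ->]|[ty -> _]]; subst;
  rewrite ?eqxx // in xy *; rewrite t_adj // ?tu ?tv.
  - by rewrite leqNgt tv (negPf E01).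
  - by rewrite ty E2'.
  - by rewrite leqNgt tu edge_sym (negPf E01).
  - by rewrite ty E2'.
  - by rewrite ltnNge tx /= edge_sym E2'.
  - by rewrite ltnNge tx /= edge_sym E2'.
  by rewrite ltnNge tx /= (same x y) // eqxx orbT E22.
split.
  constructor 1; apply: (embeds_to_list (h := h)) => // [x|].
    case: (h_cases x) => [[_ ->]|[_ ->]|[tx -> px]] //.
    by rewrite -[4]/(2 + 2) ltn_add2l; apply: leq_trans px (le2 x tx).
  apply: hadj => // [[|[|?]]//|x y xy tx ty].
  have txy := same x y tx ty.
  have := leq_trans (pos_lt x) (le2 x tx); have := leq_trans (pos_lt y) (le2 y ty).
  have : pos x != pos y by apply: contra_neq xy; apply: pos_inj.
  by case: (pos x) => [|[|?]]; case: (pos y) => [|[|?]].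
have [|le1] := small_or_K3; first by constructor 1.
have pos0 x : 1 < t x -> pos x = 0.
  by move=> tx; apply/eqP; rewrite -leqn0 -ltnS; apply: leq_trans (pos_lt x) (le1 u _ tu tx).
(* [P3] has its centre at 0, where the clique vertex, with [h x = 2], is sent. *)
constructor 2; apply: (embeds_to_list (h := fun x => nth 0 [:: 1; 2; 0] (h x))).
- by move=> x; case: (h x) => [|[|[|?]]] //=; rewrite nth_nil.
- move=> x y hxy; apply: h_inj; move: hxy.
  case: (h_cases x) => [[_ ->]|[_ ->]|[/pos0 px -> _]];
  case: (h_cases y) => [[_ ->]|[_ ->]|[/pos0 py -> _]]; by rewrite ?px ?py.
move=> x y xy; rewrite (hadj [:: (0, 2); (1, 2); (0, 3); (1, 3)]) //; last first.
- move=> x' y' xy' tx' ty'; case/eqP: xy'; apply: pos_inj; first exact: same.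
  by rewrite !pos0.
- by case=> [|[|?]].
case: (h_cases x) => [[_ ->]|[_ ->]|[/pos0 px -> _]];
case: (h_cases y) => [[_ ->]|[_ ->]|[/pos0 py -> _]]; by rewrite ?px ?py.
Qed.

Let cells (sz : nat -> nat) : seq (nat * nat) :=
  flatten [seq [seq (i, p) | p <- iota 0 (sz i)] | i <- [:: 2; 3; 4]].

(** A certificate for one cut vertex: it goes to [c], and [k] places the cells of the three cliques,
    whose sizes are bounded by [sz]. *)
Let cells_check n E c (k : nat * nat -> nat) sz : bool :=
  [&& c < n,
      all (fun q => [&& k q < n, k q != c & edge E c (k q)]) (cells sz) &
      all (fun q => all (fun q' => (q == q') ||
        (k q != k q') && (edge E (k q) (k q') == (q.1 == q'.1))) (cells sz)) (cells sz)].

Let embeds_cells u n E c k sz :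
  t u < 2 -> (forall x, t x < 2 -> x = u) -> cells_check n E c k sz ->
  (forall i, 1 < i < 5 -> #|fibre i| <= sz i) -> embeds B (list_graph n E).
Proof.
move=> tu cut /and3P[c_lt /allP k1 /allP k2] fibre_sz.
have big x : x != u -> 1 < t x.
  by move=> xu; rewrite ltnNge -ltnS; apply: contra xu => /cut ->.
pose cell x := (t x, pos x).
have cell_mem x : x != u -> cell x \in cells sz.
  move=> xu; have tx : 1 < t x < 5 by rewrite big ?t_lt.
  apply/flatten_mapP; exists (t x); first by case: (t x) tx => [|[|[|[|[|?]]]]].
  by apply: map_f; rewrite mem_iota; apply: leq_trans (pos_lt x) (fibre_sz _ tx).
have cell_inj x y : cell x = cell y -> x = y by case; apply: pos_inj.
have k_inj x y : x != u -> y != u -> x != y ->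
    k (cell x) != k (cell y) /\ edge E (k (cell x)) (k (cell y)) = (t x == t y).
  move=> xu yu xy; have /allP/(_ _ (cell_mem y yu)) := k2 _ (cell_mem x xu).
  case/orP=> [/eqP/cell_inj/eqP|/andP[? /eqP //]]; by rewrite (negPf xy).
apply: (embeds_to_list (h := fun x => if x == u then c else k (cell x))).
- move=> x; case: eqVneq => // xu; by have /and3P[] := k1 _ (cell_mem x xu).
- move=> x y; have [->|xu] := eqVneq x u; have [->|yu] := eqVneq y u => //.
  + by have /and3P[_ /eqP ne _] := k1 _ (cell_mem y yu) => /esym.
  + by have /and3P[_ /eqP ne _] := k1 _ (cell_mem x xu).
  move=> kxy; apply/eqP; apply: contraT => xy.
  by have [] := k_inj x y xu yu xy; rewrite kxy eqxx.
move=> x y xy; rewrite t_adj //.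
have [xu|xu] := eqVneq x u; have [yu|yu] := eqVneq y u.
- by rewrite xu yu eqxx in xy.
- by have /and3P[_ _ ->] := k1 _ (cell_mem y yu); rewrite xu tu big.
- by have /and3P[_ _ E1] := k1 _ (cell_mem x xu); rewrite yu tu ltnNge big //= edge_sym E1.
by have [_ ->] := k_inj x y xu yu xy; rewrite [t x < 2]ltnNge [t y < 2]ltnNge !big.
Qed.

Let card_cells u : t u < 2 -> #|fibre 2| + #|fibre 3| + #|fibre 4| < #|B|.
Proof.
move=> tu; have := max_card (mem (u |: (fibre 2 :|: fibre 3 :|: fibre 4))).
have disj (X Y : {set B}) : [disjoint X & Y] -> #|X :|: Y| = #|X| + #|Y|.
  by rewrite -leq_card_setU => /eqP.
rewrite cardsU1 !inE !disj.
- by case: (t u) tu => [|[|]].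
- by rewrite disjoint_subset; apply/subsetP => x; rewrite !inE => /eqP ->.
by rewrite disjoint_subset; apply/subsetP => x; rewrite !inE => /orP[] /eqP ->.
Qed.

Let three_types (P : nat -> bool) : (forall i, 1 < i < 5 -> P i) \/
  exists2 i, 1 < i < 5 & ~~ P i.
Proof.
have [all_P|some_P] := classic (forall i, 1 < i < 5 -> P i); first by left.
have [i Pi] := not_all_ex_not _ _ some_P; have [i_rg /negP] := imply_to_and _ _ Pi.
by right; exists i.
Qed.

(** Each clique contributes at most two vertices: two from every clique give W, and otherwise [B]
    fits into W^*. Without triangles the bound is one vertex, and the same alternative gives the
    claw or a subgraph of P_3. *)
Let class_one_cut u : t u < 2 -> (forall x, t x < 2 -> x = u) -> class_type.
Proof.
move=> tu cut.
have le2 i : 1 < i < 5 -> #|fibre i| <= 2 by case/andP=> i_gt1 _; apply: fibre_le2 tu i_gt1.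
split.
  have [gt1|[i i_rg]] := three_types (fun i => 1 < #|fibre i|).
    have BW : embeds B windmill.
      by apply: (@embeds_cells u _ _ 0 (fun q => (2 * q.1) - 3 + q.2) (fun=> 2)).
    constructor 3; split=> //; apply: embeds_inv BW _.
    rewrite card_ord; apply: leq_ltn_trans _ (card_cells tu).
    by rewrite (leq_add (leq_add (gt1 2 _) (gt1 3 _)) (gt1 4 _)).
  rewrite -leqNgt => i_le1; constructor 2.
  (* The clique [i] with at most one vertex supplies the pendant vertex 1; the other two, renumbered
     by skipping [i], supply the edges 2-3 and 4-5. *)
  apply: (@embeds_cells u _ _ 0
    (fun q => if q.1 == i then 1 else 2 + 2 * (q.1 - 2 - (i < q.1)) + q.2)
    (fun j => if j == i then 1 else 2)) => //.
    by move: i i_rg {i_le1} => [|[|[|[|[|?]]]]].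
  by move=> j j_rg; case: eqP => [->//|_]; apply: le2.
have [|le1] := small_or_K3; first by constructor 1.
have {}le1 i : 1 < i < 5 -> #|fibre i| <= 1 by case/andP=> ? _; apply: (le1 u).
have [gt0|[i i_rg]] := three_types (fun i => 0 < #|fibre i|).
  have BS : embeds B star3.
    by apply: (@embeds_cells u _ _ 0 (fun q => q.1.-1) (fun=> 1)).
  constructor 3; split=> //; apply: embeds_inv BS _.
  rewrite card_ord; apply: leq_ltn_trans _ (card_cells tu).
  by rewrite (leq_add (leq_add (gt0 2 _) (gt0 3 _)) (gt0 4 _)).
rewrite -leqNgt => i_le0; constructor 2.
apply: (@embeds_cells u _ _ 0 (fun q => 1 + (q.1 - 2 - (i < q.1)))
  (fun j => if j == i then 0 else 1)) => //.
  by move: i i_rg {i_le0} => [|[|[|[|[|?]]]]].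
by move=> j j_rg; case: eqP => [->//|_]; apply: le1.
Qed.

Lemma cliques_over_2K1_class : class_type.
Proof.
have [/existsP[u tu]|none] := boolP [exists u, t u < 2]; last first.
  apply: class_no_cut => x; rewrite ltnNge -ltnS.
  by apply: contra none => tx; apply/existsP; exists x.
have [/existsP[v /andP[tv uv]]|one] := boolP [exists v, (t v < 2) && (u != v)].
  exact: class_two_cuts tu tv uv.
apply: class_one_cut tu _ => x tx; apply/eqP; apply: contraNT one => xu.
by apply/existsP; exists x; rewrite tx eq_sym.
Qed.

End CliquesOver2K1.

(** * The pair of forbidden subgraphs *)

Definition below_some_family (A B : sgraph) : Prop :=
  exists2 i : nat, 1 <= i <= 7 & graph_set_le (graph_pair A B) (forbidden_family i).

Lemma below_sym A B : below_some_family A B -> below_some_family B A.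
Proof.
case=> i i_rg AB; exists i => // H2 /AB[H1 [->|->] H12].
  by exists A; first right.
by exists B; first left.
Qed.

Lemma pair_le A B X Y :
  embeds A X \/ embeds B X -> embeds A Y \/ embeds B Y ->
  graph_set_le (graph_pair A B) (graph_pair X Y).
Proof.
move=> ABX ABY H2 [->|->]; [case: ABX | case: ABY] => /embeds_induced H;
by [exists A; first left | exists B; first right].
Qed.

Lemma P3_star3 : embeds P3 star3.
Proof.
by apply: (@embeds_list star3 _ _ (@Ordinal 4 0 isT)
  [:: @Ordinal 4 0 isT; @Ordinal 4 1 isT; @Ordinal 4 2 isT]).
Qed.

Lemma P3_Z4 : embeds P3 Z4.
Proof.
by apply: (@embeds_list Z4 _ _ (@Ordinal 7 0 isT)
  [:: @Ordinal 7 0 isT; @Ordinal 7 1 isT; @Ordinal 7 3 isT]).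
Qed.

Lemma path3_P3 : embeds (path_graph 3) P3.
Proof.
apply: (@embeds_to_list (path_graph 3) _ _ (fun i => nth 0 [:: 1; 0; 2] i)).
- by move=> [[|[|[|?]]] ?].
- by move=> [[|[|[|?]]] ?] [[|[|[|?]]] ?] //= _; apply: val_inj.
by move=> [[|[|[|?]]] ?] [[|[|[|?]]] ?].
Qed.

(** P_3 lies in both the claw and Z_4, so [A] alone handles the first family. *)
Lemma below_of_P3 A B : embeds A P3 -> below_some_family A B.
Proof.
move=> AP; exists 1 => //; apply: pair_le; left.
  by apply: embeds_trans star3_claw; apply: embeds_trans P3_star3.
by apply: embeds_trans Z4_Zgraph; apply: embeds_trans P3_Z4.
Qed.

Lemma below_of_spider A B l : forces A B -> connected B -> legged false A l ->
  [/\ 1 < l 0, 0 < l 1 & 0 < l 2] -> below_some_family A B.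
Proof.
move=> AB B_conn Al [l0 l1 l2]; have [SA A_class] := spider_class Al l0 l1 l2.
have [l' [Bl' l'1 l'2]] : exists l', [/\ legged true B l', l' 1 <= l' 0 & l' 2 <= l' 1].
  have [n [_ B_le [An|Bn]]] := forces_ladder true AB.
    by case: (no_pattern SA (@star3_free_prism_ladder n) An).
  by have [l' Bl'] := ladder_legs B_conn B_le Bn; apply: legged_sorted Bl'.
have B_net : [\/ embeds B Z4, embeds B B12 | embeds B N111].
  case: (net_class Bl' l'1 l'2) => [//|[IB|UB]].
    have [m Bm] := star3_forces_clique_prism AB SA.
    by case: (no_pattern IB (@independent4_free_clique_prism m) Bm).
  have [m Bm] := star3_forces_diamond_prism AB SA.
  by case: (no_pattern UB (@bull22_free_diamond_prism m) Bm).
case: A_class => [AS|[PA A_class]].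
  have A_claw := embeds_trans AS star3_claw.
  case: B_net => BN; [exists 1 | exists 2 | exists 3] => //; apply: pair_le; auto; right.
  - exact: embeds_trans BN Z4_Zgraph.
  - exact: embeds_trans BN B12_Bgraph.
  - exact: embeds_trans BN N111_Ngraph.
case: (net_P4_class Bl' l'1 l'2) => [PB|BP|[BZ KB]].
- have [m Bm] := P4_forces_cliques_over_K2 AB PA.
  by case: (no_pattern PB (@P4_free_cliques_over_K2 m) Bm).
- exact/below_sym/below_of_P3.
case: A_class => [AS|SA'].
  exists 5 => //; apply: pair_le; [left | right].
    exact: embeds_trans AS spider222_claw_star.
  exact: embeds_trans BZ Z1_Zgraph.
have [m Bm] := spider113_forces_leaves_over_2K1 AB SA'.
by case: (no_pattern KB (@K3_free_leaves_over_2K1 m) Bm).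
Qed.

Lemma below_of_path A B k : forces A B -> connected B -> 3 <= #|B| ->
  embeds A (path_graph k) -> embeds (path_graph k) A -> below_some_family A B.
Proof.
move=> AB B_conn B_order A_le A_ge.
have path_le n : k <= n -> embeds A (path_graph n).
  by move=> kn; apply: embeds_trans A_le _; apply: path_graph_sub.
have path_ge n : n <= k -> embeds (path_graph n) A.
  by move=> nk; apply: embeds_trans A_ge; apply: path_graph_sub.
have [k_le3|k_gt3] := leqP k 3.
  by apply: below_of_P3; apply: embeds_trans path3_P3; apply: path_le.
have P4A : embeds P4 A := embeds_trans P4_path (path_ge 4 k_gt3).
have [m [f f_inj f_adj]] := P4_forces_cliques_over_2K1 AB P4A.
have B_C4 : ~ embeds C4 B.
  have [m' Bm'] := P4_forces_cliques_over_K2 AB P4A.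
  by move=> CB; case: (no_pattern CB (@C4_free_cliques_over_K2 m') Bm').
have B_K4 : ~ embeds K4 B.
  have [m' Bm'] := P4_forces_stars_over_2K1 AB P4A.
  by move=> KB; case: (no_pattern KB (@K4_free_stars_over_2K1 m') Bm').
have [B_class B_class'] := cliques_over_2K1_class f_inj f_adj B_conn B_order B_K4 B_C4.
have [k_le5|k_gt5] := leqP k 5.
  have AP5 := path_le 5 k_le5.
  case: B_class => [BD|BW|[BW WB]].
  - exists 7 => //; apply: pair_le; [by left | right].
    exact: embeds_trans BD diamond_K4minus.
  - exists 6 => //; apply: pair_le; [by left | right].
    exact: embeds_trans BW broken_windmill_Wstar.
  have [k_le4|k_gt4] := leqP k 4.
    exists 4 => //; apply: pair_le; [by left; apply: path_le | right].
    exact: embeds_trans BW windmill_Wgraph.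
  have [m' Bm'] := P5_forces_windmill_free AB (embeds_trans P5_path (path_ge 5 k_gt4)).
  by case: (no_pattern WB (@windmill_free_free m') Bm').
case: B_class' => [KB|BP|[SB BS]].
- have [m' Bm'] := P6_forces_leaves_over_2K1 AB (embeds_trans P6_path (path_ge 6 k_gt5)).
  by case: (no_pattern KB (@K3_free_leaves_over_2K1 m') Bm').
- exact/below_sym/below_of_P3.
(* Now [B] is the claw. P_6 lies in Z_4, so the first family applies with [A] and [B] in exchanged
   roles. *)
have [k_le6|k_gt6] := leqP k 6.
  exists 1 => //; apply: pair_le; [right | left].
    exact: embeds_trans BS star3_claw.
  by apply: embeds_trans Z4_Zgraph; apply: embeds_trans path6_Z4; apply: path_le.
have IA := embeds_trans independent4_path7 (path_ge 7 k_gt6).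
have [m' Bm'] := independent4_forces_clique_prism AB IA.
by case: (no_pattern SB (@star3_free_clique_prism m') Bm').
Qed.

Lemma below_of_theta A B n : forces A B -> connected A -> connected B ->
  3 <= #|B| -> #|A| <= n -> embeds A (ladder false n) -> below_some_family A B.
Proof.
move=> AB A_conn B_conn B_order A_le An.
have [l Al] := ladder_legs A_conn A_le An.
case: (spider_or_path A_conn Al) => [l_gt0|[k [A_k k_A]]].
  exact: below_of_spider AB B_conn Al l_gt0.
exact: below_of_path AB B_conn B_order A_k k_A.
Qed.

Theorem theorem1 (A B : sgraph)
  (AB_distinct : ~ isomorphic A B)
  (A_connected : connected A) (B_connected : connected B)
  (A_order : 3 <= #|A|) (B_order : 3 <= #|B|)
  (dominating_of_free : exists2 n0 : nat, 0 < n0 &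
     forall G : sgraph, k_connected 2 G -> graph_free (graph_pair A B) G ->
       n0 <= #|G| -> has_dominating_cycle G) :
  exists2 i : nat, 1 <= i <= 7 &
    graph_set_le (graph_pair A B) (forbidden_family i).
Proof.
have AB : forces A B.
  case: dominating_of_free => n0 _ G_dom; exists n0 => G G_conn G_large G_nodom.
  apply: NNPP => none; apply: G_nodom; apply: G_dom => // H HAB /induced_embeds HG.
  by apply: none; case: HAB HG => ->; [left | right].
have [n [A_le B_le [An|Bn]]] := forces_ladder false AB.
  exact: below_of_theta AB A_connected B_connected B_order A_le An.
apply: below_sym.
exact: below_of_theta (forces_sym AB) B_connected A_connected A_order B_le Bn.
Qed.
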